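(* Let $\beta>0$ and let $A\sim H_\beta$ be a $2\times 2$ tridiagonal $\beta$-Hermite random matrix. Then the number of row swaps used by Gaussian elimination with partial pivoting on $A$ is a Bernoulli random variable with success probability $$p_\beta^{(2)} = \mathbb{P}\left(|A_{21}|>|A_{11}|\right) = \mathbb{P}\left(F_{\beta,1} > \frac{2}{\beta}\right) = 1 - I_{2/3}\left(\frac{\beta}{2},\frac{1}{2}\right).$$ In particular, $p_1^{(2)} = 1-\frac{2}{\pi}\arctan\sqrt{2}$, $p_2^{(2)} = \frac{1}{\sqrt{3}}$, and $p_4^{(2)} = \frac{4}{3\sqrt{3}}$.
   Context: For $\beta>0$, the $2\times 2$ tridiagonal $\beta$-Hermite (Dumitriu–Edelman) ensemble $H_\beta$ is the law of the real symmetric random matrix $$A = \frac{1}{\sqrt{2}}\begin{bmatrix} a_1 & b\\ b & a_2\end{bmatrix},$$ where $a_1,a_2\sim N(0,2)$ (normal with mean $0$ and variance $2$) and $b\sim\chi_\beta$ (chi distribution with $\beta$ degrees of freedom, i.e. $b\geq 0$ and $b^2\sim\chi^2_\beta$) are independent. Thus $A_{11}\sim N(0,1)$ and $A_{21}\sim\chi_\beta/\sqrt{2}$ are independent. Gaussian elimination with partial pivoting on a $2\times 2$ matrix $A$ performs one row swap if $|A_{21}|>|A_{11}|$ and no row swap otherwise. For $\mu,\nu>0$, $F_{\mu,\nu}$ denotes a random variable with the $F$ distribution with $\mu$ numerator and $\nu$ denominator degrees of freedom, i.e. $F_{\mu,\nu}\sim(\chi^2_\mu/\mu)/(\chi^2_\nu/\nu)$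 with independent numerator and denominator. The regularized incomplete beta function is $I_z(a,b) = \frac{\int_0^z t^{a-1}(1-t)^{b-1}\,dt}{\int_0^1 t^{a-1}(1-t)^{b-1}\,dt}$ for $a,b>0$ and $0\le z\le 1$. *)

(* Defs.v *)
From HB Require Import structures.
From mathcomp Require Import all_boot all_order all_algebra.
From mathcomp Require Import all_classical all_reals all_analysis.
From mathcomp Require Import measurable_realfun ring lra.

Set Implicit Arguments.
Unset Strict Implicit.
Unset Printing Implicit Defensive.

Import Order.TTheory GRing.Theory Num.Theory.
Import numFieldNormedType.Exports.

Local Open Scope classical_set_scope.
Local Open Scope ring_scope.

Definition gamma_fun {R : realType} (a : R) : R :=
  \int[lebesgue_measure]_(t in `]0, +oo[) (t `^ (a - 1) * expR (- t)).

Definition inc_beta_fun {R : realType} (z a b : R) : R :=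
  \int[lebesgue_measure]_(t in `[0, z]) (t `^ (a - 1) * (1 - t) `^ (b - 1)).

Definition reg_inc_beta {R : realType} (z a b : R) : R :=
  inc_beta_fun z a b / inc_beta_fun 1 a b.

Definition chi2_pdf {R : realType} (k x : R) : R :=
  if 0 < x then
    x `^ (k / 2 - 1) * expR (- (x / 2)) / (2 `^ (k / 2) * gamma_fun (k / 2))
  else 0.

(* k is an arbitrary positive real; the Dirac branch is a default value that
   makes chi2_prob k a probability for every k. *)
Definition chi2_prob {R : realType} (k : R) : set R -> \bar R := fun V =>
  if 0 < k then (\int[lebesgue_measure]_(x in V) (chi2_pdf k x)%:E)%E
  else \d_(0 : R) V.

Section chi2_mass.
Context {R : realType}.
Local Notation mu := (@lebesgue_measure R).

Let gamma_integrand (a t : R) := t `^ (a - 1) * expR (- t).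

Let gamma_integrand_ge0 a t : 0 <= gamma_integrand a t.
Proof. by rewrite mulr_ge0 ?powR_ge0 ?expR_ge0. Qed.

Let continuous_powR_pos (a x : R) : 0 < x ->
  continuous_at x (fun y : R => y `^ a).
Proof.
move=> x0; apply: differentiable_continuous; apply/derivable1_diffP.
by apply: derivable_powR; rewrite in_itv/= x0.
Qed.

Let continuous_gamma_integrand (a x : R) : 0 < x ->
  continuous_at x (gamma_integrand a).
Proof.
move=> x0; apply: cvgM; first exact: continuous_powR_pos.
apply: (@continuous_comp _ _ _ -%R (@expR R)); first exact: opp_continuous.
exact: continuous_expR.
Qed.

Let measurable_gamma_integrand a : measurable_fun [set: R] (gamma_integrand a).
Proof.
apply: measurable_funM; first exact: measurable_powR.
exact: measurableT_comp.
Qed.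

Let cvg_integral_oy (f : R -> R) (c : R) : 0 < c ->
    measurable_fun [set: R] f -> (forall x, 0 <= f x) ->
  (\int[mu]_(x in `[(c / n.+1%:R)%R, +oo[) (f x)%:E)%E @[n --> \oo]
    --> (\int[mu]_(x in `]0%R, +oo[) (f x)%:E)%E.
Proof.
move=> c0 mf f0.
have -> : `]0%R, +oo[%classic = \bigcup_n `[(c / n.+1%:R)%R, +oo[%classic.
  apply/seteqP; split => [x /=|x [n _] /=]; rewrite !in_itv/= !andbT => x0.
    have xc0 : 0 < x / c by rewrite divr_gt0.
    near \oo => n; exists n => //=; rewrite in_itv/= andbT.
    rewrite mulrC -ler_pdivlMr// ltW//.
    near: n; exact: (near_infty_natSinv_lt (PosNum xc0)).
  by apply: lt_le_trans x0; rewrite divr_gt0.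
apply: ge0_nondecreasing_set_cvg_integral => //.
- move=> m n mn; apply/subsetPset => x /=; rewrite !in_itv/= !andbT.
  by apply: le_trans; rewrite ler_pM2l// lef_pV2 ?posrE// ler_nat.
- by move=> n; apply/measurable_funTS/measurable_EFinP.
- by move=> n x _; rewrite lee_fin.
Unshelve. all: end_near. Qed.

Let integral_powR_le (a e : R) : 0 < a -> 0 < e < 1 ->
  (\int[mu]_(x in `[e, 1%R]) (x `^ (a - 1))%:E <= (a^-1)%:E)%E.
Proof.
move=> a0 /andP[e0 e1].
have cp (x : R) : 0 < x -> continuous_at x (fun y : R => y `^ a / a).
  move=> x0; apply: cvgM; first exact: continuous_powR_pos.
  exact: cvg_cst.
rewrite (@continuous_FTC2 _ _ (fun x => x `^ a / a)) //.
- rewrite -EFinB lee_fin powR1 mul1r lerBlDr lerDl.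
  by rewrite divr_ge0 ?powR_ge0// ltW.
- apply: continuous_in_subspaceT => x; rewrite inE/= in_itv/= => /andP[ex _].
  by apply: continuous_powR_pos; exact: lt_le_trans ex.
- split.
  + move=> x; rewrite in_itv/= => /andP[ex _].
    apply: derivableM => //; apply: derivable_powR.
    by rewrite in_itv/= andbT (lt_trans e0).
  + by apply: cvg_at_right_filter; exact: cp.
  + by apply: cvg_at_left_filter; exact: cp.
- move=> x; rewrite in_itv/= => /andP[ex _].
  have x0 : 0 < x by exact: lt_trans ex.
  under eq_fun do rewrite mulrC.
  rewrite derive1Ml; last by apply: derivable_powR; rewrite in_itv/= x0.
  by rewrite powR_derive1 ?in_itv/= ?x0// mulrA mulVf ?gt_eqF// mul1r.
Qed.

Let gamma_integrand_le_expR (a t : R) : 0 < a -> 1 <= t ->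
  gamma_integrand a t <= (2 * a) `^ a * 2 * exponential_pdf (2^-1) t.
Proof.
move=> a0 t1; have t0 : 0 < t by exact: lt_le_trans t1.
rewrite exponential_pdfE ?(ltW t0)// -mulrA (mulrA 2) divff// mul1r.
rewrite /gamma_integrand.
have h : t `^ (a - 1) <= (2 * a) `^ a * expR (t / 2).
  apply: (@le_trans _ _ (t `^ a)); first by apply: ler_powR => //; lra.
  have a2 : 0 < 2 * a by rewrite mulr_gt0.
  have tE : t = 2 * a * (t / (2 * a)) by rewrite mulrC divfK// gt_eqF.
  rewrite {1}tE powRM ?(ltW a2) ?divr_ge0 ?(ltW t0) ?(ltW a2)//.
  apply: ler_wpM2l; first exact: powR_ge0.
  have -> : expR (t / 2) = expR (t / (2 * a)) `^ a.
    rewrite -expRM; congr expR; field; rewrite ?gt_eqF//.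
  apply: ge0_ler_powR; rewrite ?nnegrE ?expR_ge0 ?divr_ge0 ?mulr_ge0 ?ltW//.
  by apply: lt_le_trans (expR_ge1Dx _); rewrite ltrDr.
apply: le_trans (ler_wpM2r (expR_ge0 _) h) _.
rewrite -mulrA -expRD; apply: ler_wpM2l; first exact: powR_ge0.
by rewrite ler_expR; lra.
Qed.

Let integral_gamma_lty (a : R) : 0 < a ->
  (\int[mu]_(t in `]0%R, +oo[) (gamma_integrand a t)%:E < +oo)%E.
Proof.
move=> a0.
pose C := (2 * a) `^ a * 2.
have C0 : 0 <= C by rewrite mulr_ge0 ?powR_ge0.
have mG D : measurable_fun D (EFin \o gamma_integrand a).
  by apply/measurable_funTS/measurable_EFinP.
have mE D : measurable_fun D (EFin \o exponential_pdf (2^-1 : R)).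
  by apply/measurable_funTS/measurable_EFinP; exact: measurable_exponential_pdf.
apply: (@le_lt_trans _ _ ((a^-1)%:E + C%:E)%E); last by rewrite ltry.
have h1y : (\int[mu]_(t in `]1%R, +oo[) (gamma_integrand a t)%:E <= C%:E)%E.
  apply: (@le_trans _ _ (\int[mu]_(t in `]1%R, +oo[)
      (C%:E * (exponential_pdf (2^-1) t)%:E))%E).
    apply: ge0_le_integral => //.
    - by move=> x _; rewrite lee_fin.
    - exact: mG.
      by apply: measurable_funeM; exact: mE.
    - move=> x /=; rewrite in_itv/= andbT => /ltW x1.
      by rewrite -EFinM lee_fin; exact: gamma_integrand_le_expR.
  rewrite ge0_integralZl_EFin//; last 2 first.
    by move=> x _; rewrite lee_fin exponential_pdf_ge0// invr_ge0.
    exact: mE.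
  rewrite -[leRHS]mule1; apply: lee_wpmul2l; first by rewrite lee_fin.
  rewrite -(@integral_exponential_pdf R (2^-1)) ?invr_gt0//.
  apply: ge0_subset_integral => //; first exact: mE.
  by move=> x _; rewrite lee_fin exponential_pdf_ge0// invr_ge0.
apply: (@cvge_le _ _ _ _ _ _ _ _
  (@cvg_integral_oy (gamma_integrand a) 2^-1 _ _ _)).
4: exact: gamma_integrand_ge0.
2: by rewrite invr_gt0.
2: exact: measurable_gamma_integrand.
near=> n.
have e0 : 0 < 2^-1 / n.+1%:R :> R by rewrite divr_gt0// invr_gt0.
have e1 : 2^-1 / n.+1%:R < 1 :> R.
  rewrite ltr_pdivrMr// mul1r (@lt_le_trans _ _ 1)// ?invf_lt1 ?ltr1n//.
  by rewrite ler1n.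
set e := _ / _ in e0 e1 *.
have -> : `[e, +oo[%classic = `[e, 1] `|` `]1, +oo[%classic :> set R.
  apply/seteqP; split => x /=; rewrite !in_itv/= !andbT.
    by move=> ->; have [|] := leP x 1; [left|right].
  by move=> [/andP[]//|x1]; apply: ltW; exact: lt_trans x1.
rewrite ge0_integral_setU//; last 3 first.
  exact: mG.
  by move=> x _; rewrite lee_fin.
  apply/disj_setPS => x /=; rewrite !in_itv/= andbT => -[/andP[_ x1]].
  by rewrite ltNge x1.
apply: le_trans (leeD (@integral_powR_le a e a0 _) h1y); last by rewrite e0 e1.
apply: leeD2r; apply: ge0_le_integral => //.
- by move=> x _; rewrite lee_fin.
- exact: mG.
- by apply/measurable_funTS/measurable_EFinP; exact: measurable_powR.
- move=> x /=; rewrite in_itv/= => /andP[ex _]; rewrite lee_fin.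
  apply: ler_piMr; first exact: powR_ge0.
  by rewrite -expR0 ler_expR oppr_le0 ltW// (lt_le_trans e0).
Unshelve. all: end_near. Qed.

Let integral_gamma_gt0 (a : R) : 0 < a ->
  (0 < \int[mu]_(t in `]0%R, +oo[) (gamma_integrand a t)%:E)%E.
Proof.
move=> a0.
have mG D : measurable_fun D (EFin \o gamma_integrand a).
  by apply/measurable_funTS/measurable_EFinP.
apply: (@lt_le_trans _ _ (\int[mu]_(t in `[1%R, 2%R])
    (2^-1 * expR (- 2))%:E)%E).
  rewrite integral_cst//= lebesgue_measure_itv/= lte_fin ltr1n -EFinB -EFinM.
  by rewrite lte_fin mulr_gt0 ?mulr_gt0 ?expR_gt0 ?invr_gt0// subr_gt0 ltr1n.
apply: (@le_trans _ _ (\int[mu]_(t in `[1%R, 2%R]) (gamma_integrand a t)%:E)%E).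
  apply: ge0_le_integral => //.
  - exact: mG.
  - move=> x /=; rewrite in_itv/= => H; move: H => /andP[x1 x2]; rewrite lee_fin.
    apply: ler_pM; rewrite ?expR_ge0 ?invr_ge0 ?ler_expR ?lerN2//.
    apply: (@le_trans _ _ (x `^ (- 1))); last by apply: ler_powR => //; lra.
    rewrite powR_inv1 ?(le_trans ler01 x1)// lef_pV2 ?posrE//.
    exact: lt_le_trans x1.
apply: ge0_subset_integral => //.
- exact: mG.
- by move=> x _; rewrite lee_fin.
- by move=> x /=; rewrite !in_itv/= andbT => /andP[x1 _]; exact: lt_le_trans x1.
Qed.

Let integral_gamma_half (a : R) :
  (\int[mu]_(t in `]0%R, +oo[) (gamma_integrand a (t / 2) * 2^-1)%:E =
   \int[mu]_(t in `]0%R, +oo[) (gamma_integrand a t)%:E)%E.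
Proof.
pose F (x : R) := x / 2.
have dF (x : R) : is_derive x 1 (F : R -> R^o) (2^-1 : R).
  rewrite (_ : F = 2^-1 \*: id); last by apply/funext => y; rewrite /F mulrC.
  by apply: is_derive_eq; rewrite scaler1.
have F'E : F^`()%classic = cst (2^-1 : R).
  by apply/funext => x; rewrite derive1E derive_val.
have I1 := @cvg_integral_oy (gamma_integrand a) 1 ltr01
  (@measurable_gamma_integrand a) (gamma_integrand_ge0 a).
have I2 : (\int[mu]_(x in `[(2 / n.+1%:R)%R, +oo[)
     (gamma_integrand a (x / 2) * 2^-1)%:E)%E @[n --> \oo] -->
   (\int[mu]_(t in `]0%R, +oo[) (gamma_integrand a (t / 2) * 2^-1)%:E)%E.
  apply: (@cvg_integral_oy (fun x => gamma_integrand a (x / 2) * 2^-1) 2) => //.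
    apply: measurable_funM => //.
    apply: (measurableT_comp (@measurable_gamma_integrand a)).
    exact: measurable_funM.
  by move=> x; rewrite mulr_ge0 ?invr_ge0.
apply: (cvg_unique _ I2) => //.
rewrite (_ : (fun n => _) = (fun n =>
  \int[mu]_(x in `[(1 / n.+1%:R)%R, +oo[) (gamma_integrand a x)%:E))%E //.
apply/funext => n.
have e0 : 0 < 2 / n.+1%:R :> R by rewrite divr_gt0.
have Fe : F (2 / n.+1%:R) = 1 / n.+1%:R.
  by rewrite /F mulrAC divff.
rewrite -Fe [RHS](@increasing_ge0_integration_by_substitutiony _ F).
- by apply: eq_integral => x _; rewrite F'E.
- by move=> x y _ _ xy; rewrite /F ltr_pM2r ?invr_gt0.
- by rewrite F'E => x _; exact: cvg_cst.
- by rewrite F'E; exact: is_cvg_cst.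
- by rewrite F'E; exact: is_cvg_cst.
- split; first by move=> x _; exact: ex_derive.
  apply: cvg_at_right_filter; apply: differentiable_continuous.
  by apply/derivable1_diffP; exact: ex_derive.
- by apply/gt0_cvgMly; rewrite ?invr_gt0//; exact: cvg_id.
- apply: continuous_in_subspaceT => x; rewrite inE/= in_itv/= andbT => ex.
  apply: continuous_gamma_integrand; apply: lt_le_trans ex.
  by rewrite Fe divr_gt0.
- by move=> x _.
Qed.

Lemma chi2_prob_setT (k : R) : chi2_prob k [set: R] = 1%E.
Proof.
rewrite /chi2_prob; case: ifPn => [k0|_]; last by rewrite diracT.
have a0 : 0 < k / 2 by rewrite divr_gt0.
set a := k / 2 in a0 *.
pose I := (\int[mu]_(t in `]0%R, +oo[) (gamma_integrand a t)%:E)%E.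
have IE : I = (gamma_fun a)%:E.
  rewrite /gamma_fun /Rintegral fineK// ge0_fin_numE; first exact: integral_gamma_lty.
  by apply: integral_ge0 => x _; rewrite lee_fin gamma_integrand_ge0.
have g0 : 0 < gamma_fun a by rewrite -lte_fin -IE; exact: integral_gamma_gt0.
transitivity (\int[mu]_(t in `]0%R, +oo[)
    (((gamma_fun a)^-1)%:E * (gamma_integrand a (t / 2) * 2^-1)%:E))%E.
  rewrite [RHS]integral_mkcond; apply: eq_integral => x _.
  rewrite patchE mem_setE in_itv/= andbT /chi2_pdf -/a; case: ifP => // x0.
  rewrite -EFinM; congr EFin; rewrite /gamma_integrand.
  rewrite powRM ?(ltW x0) ?invr_ge0//.
  have -> : 2^-1 `^ (a - 1) = 2 * (2 `^ a)^-1 :> R.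
    rewrite -powR_inv1// -powRrM mulN1r opprB.
    by rewrite powRD ?powRr1 ?powRN// pnatr_eq0 implybT.
  by field; rewrite ?gt_eqF ?powR_gt0.
rewrite ge0_integralZl_EFin//; last 3 first.
- by move=> x _; rewrite lee_fin mulr_ge0 ?invr_ge0 ?gamma_integrand_ge0.
- apply/measurable_funTS/measurable_EFinP; apply: measurable_funM => //.
  apply: (measurableT_comp (@measurable_gamma_integrand a)).
  exact: measurable_funM.
- by rewrite invr_ge0 ltW.
by rewrite integral_gamma_half -/I IE -EFinM mulVf// gt_eqF.
Qed.

End chi2_mass.

Section chi2_probability.
Context {R : realType}.

Lemma gamma_fun_ge0 (a : R) : 0 <= gamma_fun a.
Proof.
by apply: Rintegral_ge0 => x _; rewrite mulr_ge0 ?powR_ge0 ?expR_ge0.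
Qed.

Lemma chi2_pdf_ge0 (k x : R) : 0 <= chi2_pdf k x.
Proof.
rewrite /chi2_pdf; case: ifP => // _.
by rewrite divr_ge0 ?mulr_ge0 ?powR_ge0 ?expR_ge0 ?gamma_fun_ge0.
Qed.

Lemma measurable_chi2_pdf (k : R) : measurable_fun [set: R] (chi2_pdf k).
Proof.
apply: measurable_fun_ifT => //; first exact: measurable_fun_ltr.
apply: measurable_funM => //; apply: measurable_funM.
  exact: measurable_powR.
apply: measurableT_comp => //; apply: measurableT_comp => //.
exact: measurable_funM.
Qed.

Variable k : R.

Let chi20 : chi2_prob k set0 = 0%E.
Proof. by rewrite /chi2_prob; case: ifP; rewrite ?integral_set0// measure0. Qed.

Let chi2_ge0 A : (0 <= chi2_prob k A)%E.
Proof.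
rewrite /chi2_prob; case: ifP => // _.
by apply: integral_ge0 => x _; rewrite lee_fin chi2_pdf_ge0.
Qed.

Let chi2_sigma_additive : semi_sigma_additive (chi2_prob k).
Proof.
move=> F mF tF mUF; rewrite /chi2_prob; case: ifP => _; last first.
  exact: measure_semi_sigma_additive.
apply: cvg_toP.
  apply: ereal_nondecreasing_is_cvgn => m n mn.
  apply: lee_sum_nneg_natr => // i _ _; apply: integral_ge0 => x _.
  by rewrite lee_fin chi2_pdf_ge0.
rewrite ge0_integral_bigcup//=.
- apply/measurable_funTS/measurableT_comp => //.
  exact: measurable_chi2_pdf.
- by move=> x _; rewrite lee_fin chi2_pdf_ge0.
Qed.

HB.instance Definition _ := isMeasure.Build _ _ _ (chi2_prob k)
  chi20 chi2_ge0 chi2_sigma_additive.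

HB.instance Definition _ := Measure_isProbability.Build _ _ R (chi2_prob k)
  (chi2_prob_setT k).

End chi2_probability.

(* normal_prob m s (mean m, standard deviation s) is a probability on
   measurableTypeR R, which has the same sigma-algebra as R but another display;
   normal_law is the same set function, as a probability on R. *)
Definition normal_law {R : realType} (m s : R) : set R -> \bar R :=
  normal_prob m s.

Section normal_law.
Context {R : realType} (m s : R).

Let normal_law0 : normal_law m s set0 = 0%E.
Proof. exact: (measure0 (normal_prob m s)). Qed.

Let normal_law_ge0 A : (0 <= normal_law m s A)%E.
Proof. exact: (measure_ge0 (normal_prob m s)). Qed.

Let normal_law_sigma_additive : semi_sigma_additive (normal_law m s).
Proof. exact: (@measure_semi_sigma_additive _ _ _ (normal_prob m s)). Qed.

HB.instance Definition _ := isMeasure.Build _ _ _ (normal_law m s)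
  normal_law0 normal_law_ge0 normal_law_sigma_additive.

Let normal_law_setT : normal_law m s [set: R] = 1%E.
Proof. exact: (probability_setT (normal_prob m s)). Qed.

HB.instance Definition _ := Measure_isProbability.Build _ _ R (normal_law m s)
  normal_law_setT.

End normal_law.

Section chi_probability.
Context {R : realType}.

Let measurable_sqrt : measurable_fun [set: R] (@Num.sqrt R).
Proof. by apply: continuous_measurable_fun; exact: sqrt_continuous. Qed.

HB.instance Definition _ :=
  isMeasurableFun.Build _ _ _ _ (@Num.sqrt R) measurable_sqrt.

(* Law of the nonnegative square root of a chi^2_k variable. *)
Definition chi_prob (k : R) : probability R R :=
  distribution (chi2_prob k) (@Num.sqrt R).

End chi_probability.

Section F_probability.
Context {R : realType}.

Definition F_ratio (m n : R) (x : R * R) : R := (x.1 / m) / (x.2 / n).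

Let measurable_F_ratio m n : measurable_fun [set: R * R] (F_ratio m n).
Proof.
have minv : measurable_fun [set: R] (@GRing.inv R).
  have -> : @GRing.inv R = fun y => y * (y ^+ 2) `^ (-1).
    apply/funext => y; rewrite powR_inv1 ?sqr_ge0// expr2 invfM mulrA.
    by have [->|y0] := eqVneq y 0; rewrite ?invr0 ?mulr0// divff// mul1r.
  apply: measurable_funM => //.
  apply: (measurableT_comp (@measurable_powR R (-1))).
  exact: measurable_funX.
apply: measurable_funM; first exact: measurable_funM.
by apply: (measurableT_comp minv); exact: measurable_funM.
Qed.

HB.instance Definition _ m n :=
  isMeasurableFun.Build _ _ _ _ (F_ratio m n) (measurable_F_ratio m n).

(* The product measure makes numerator and denominator independent. *)
Definition F_prob (m n : R) : probability R R :=
  distribution (chi2_prob m \x chi2_prob n)%E (F_ratio m n).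

End F_probability.

Definition measure_matrix_display : measure_display -> measure_display.
Proof. exact. Qed.

Section measurable_matrix.
Context {d} {T : measurableType d} (m n : nat).

(* Matrices carry the product sigma-algebra, generated by the entries. *)
Definition mx_entry_preimages : set (set 'M[T]_(m, n)) :=
  [set E | exists i j (B : set T),
     measurable B /\ E = [set M : 'M[T]_(m, n) | B (M i j)]].

Let mx_set0 : <<s mx_entry_preimages >> set0.
Proof. exact: sigma_algebra0. Qed.

Let mx_setC A : <<s mx_entry_preimages >> A -> <<s mx_entry_preimages >> (~` A).
Proof. exact: sigma_algebraC. Qed.

Let mx_bigcup (F : (set 'M[T]_(m, n))^nat) :
  (forall i, <<s mx_entry_preimages >> (F i)) ->
  <<s mx_entry_preimages >> (\bigcup_i (F i)).
Proof. exact: sigma_algebra_bigcup. Qed.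

HB.instance Definition _ := @isMeasurable.Build (measure_matrix_display d)
  'M[T]_(m, n) <<s mx_entry_preimages >> mx_set0 mx_setC mx_bigcup.

Lemma measurable_fun_mxP d' (S : measurableType d') (f : S -> 'M[T]_(m, n)) :
  (forall i j, measurable_fun [set: S] (fun s => f s i j)) ->
  measurable_fun [set: S] f.
Proof.
move=> mf; apply: (@measurability _ _ _ _ _ _ mx_entry_preimages) => //.
move=> _ [_ [i [j [B [mB ->]]]] <-].
exact: mf.
Qed.

Lemma measurable_mx_entry i j :
  measurable_fun [set: 'M[T]_(m, n)] (fun M => M i j).
Proof.
move=> _ B mB; rewrite setTI; apply: sub_sigma_algebra.
by exists i, j, B.
Qed.

End measurable_matrix.

Section hermite.
Context {R : realType}.

Definition hermite2_mx (x : R * R * R) : 'M[R]_2 :=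
  let: (a1, a2, b) := x in
  (Num.sqrt 2)^-1 *: \matrix_(i < 2, j < 2)
    nth 0 (nth [::] [:: [:: a1; b]; [:: b; a2]] i) j.

Let measurable_hermite2_mx : measurable_fun [set: R * R * R] hermite2_mx.
Proof.
apply: measurable_fun_mxP => i j.
have m1 : measurable_fun [set: R * R * R] (fun x => x.1.1).
  exact: measurableT_comp.
have m2 : measurable_fun [set: R * R * R] (fun x => x.1.2).
  exact: measurableT_comp.
apply: (@eq_measurable_fun _ _ _ _ _ (fun x : R * R * R => (Num.sqrt 2)^-1 *
    nth 0 (nth [::] [:: [:: x.1.1; x.2]; [:: x.2; x.1.2]] i) j)).
  by move=> [[a1 a2] b] _; rewrite /hermite2_mx !mxE.
apply: measurable_funM => //.
case: i => -[|[|i]] i2 /=; case: j => -[|[|j]] j2 /=; rewrite ?nth_nil;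
  by [exact: m1|exact: m2|exact: measurable_snd|exact: measurable_cst].
Qed.

HB.instance Definition _ :=
  isMeasurableFun.Build _ _ _ _ hermite2_mx measurable_hermite2_mx.

(* Law of hermite2_mx (a1, a2, b) for independent a1, a2 ~ N(0, 2) and
   b ~ chi_beta. *)
Definition hermite2 (beta : R) : probability 'M[R]_2 R :=
  distribution
    (normal_law 0 (Num.sqrt 2) \x normal_law 0 (Num.sqrt 2) \x chi_prob beta)%E
    hermite2_mx.

End hermite.

Definition has_law {R : realType} d (Omega : measurableType d)
    (P : probability Omega R) d' (T : measurableType d') (X : {RV P >-> T})
    (mu : probability T R) : Prop :=
  forall B : set T, measurable B -> distribution P X B = mu B.

Section gepp.
Context {R : realType}.

(* Number of row swaps of Gaussian elimination with partial pivoting: the only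
   elimination step of a 2 x 2 matrix swaps the rows exactly when the
   subdiagonal entry is strictly larger in absolute value than the pivot. *)
Definition gepp_swaps (A : 'M[R]_2) : nat :=
  if `|A 0 0| < `|A 1 0| then 1%N else 0%N.

Let measurable_gepp_swaps : measurable_fun [set: 'M[R]_2] gepp_swaps.
Proof.
apply: measurable_fun_ifT => //.
by apply: measurable_fun_ltr; apply: measurableT_comp => //;
  exact: measurable_mx_entry.
Qed.

HB.instance Definition _ :=
  isMeasurableFun.Build _ _ _ _ gepp_swaps measurable_gepp_swaps.

End gepp.

Definition swap_prob {R : realType} (beta : R) : R :=
  fine (hermite2 beta [set A | `|A 1 0| > `|A 0 0|]).

(* Main.v *)
Require Import Defs.
From HB Require Import structures.
From mathcomp Require Import all_boot all_order all_algebra.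
From mathcomp Require Import all_classical all_reals all_analysis.
From mathcomp Require Import measurable_realfun ring lra.

Set Implicit Arguments.
Unset Strict Implicit.
Unset Printing Implicit Defensive.

Import Order.TTheory GRing.Theory Num.Theory.
Import numFieldNormedType.Exports.

Local Open Scope classical_set_scope.
Local Open Scope ring_scope.

(** The rows are swapped exactly when $|b| > |a_1|$, the common factor
    $1/\sqrt 2$ of the two entries cancelling.  Write $X = b^2 \sim \chi^2_\beta$.
    As $a_1 \sim N(0, 2)$, the variable $Y = a_1^2 / 2$ is $\chi^2_1$
    ([normal_law_chi2]), so conditioning on $b$ shows that the swap event has the
    probability of $X > 2Y$ for independent $X$ and $Y$, which is the event
    $F_{\beta,1} > 2/\beta$ ([hermite2_swap_F]).

    For the tail of an $F$ variable, put $x = ys$ in the joint density of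
    independent $\chi^2_m$ and $\chi^2_n$ variables and integrate out $y$: a gamma
    integral in $y$ remains, and the ratio $s$ has a density proportional to
    $s^{a-1} (1+s)^{-(a+b)}$ with $a = m/2$ and $b = n/2$
    ([integral_chi2_ratio]).  The constant is fixed by the total mass $1$
    ([ratio_constant_total]), and $t = s/(1+s)$ turns the integrals of this density
    over $(0, z]$ and $(0, \infty)$ into the incomplete and the complete beta
    integrals ([reg_inc_betaE]).  This gives [F_prob_gt]; for $m = \beta$, $n = 1$
    and threshold $2/\beta$ one gets $z = 2$ and $z/(1+z) = 2/3$.

    For $\beta = 1, 2, 4$ the density in $s$ has the antiderivatives
    $2\arctan\sqrt s$, $2 - 2(1+s)^{-1/2}$ and
    $4/3 - 2(1+s)^{-1/2} + (2/3)(1+s)^{-3/2}$, which vanish at $0$; the special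
    values are one minus the ratio of their values at $2$ and at infinity
    ([swap_prob_antiderivative]).

    All these integrals are improper, so the file starts with a substitution rule
    for nonnegative integrands on the positive half-line. *)

(** * Substitution on the positive half-line *)

(** The integrands below may blow up at an end point of the domain, so an equality
    of integrals is first proved on closed intervals inside the domain, where
    substitution is unproblematic, and then carried to the whole domain by
    monotone convergence on both sides. *)
Lemma ge0_integral_bigcup_eq d d' (T : measurableType d) (T' : measurableType d')
    (R : realType) (m : {measure set T -> \bar R}) (m' : {measure set T' -> \bar R})
    (A : (set T)^nat) (A' : (set T')^nat) (f : T -> \bar R) (f' : T' -> \bar R) :
  (forall n, measurable (A n)) -> nondecreasing_seq A ->
  (forall n, measurable_fun (A n) f) -> (forall n x, A n x -> (0 <= f x)%E) ->
  (forall n, measurable (A' n)) -> nondecreasing_seq A' ->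
  (forall n, measurable_fun (A' n) f') -> (forall n x, A' n x -> (0 <= f' x)%E) ->
  (forall n, \int[m]_(x in A n) f x = \int[m']_(x in A' n) f' x)%E ->
  (\int[m]_(x in \bigcup_n A n) f x = \int[m']_(x in \bigcup_n A' n) f' x)%E.
Proof.
move=> mA ndA mf f0 mA' ndA' mf' f'0 AA'.
have cA := @ge0_nondecreasing_set_cvg_integral _ _ _ A f m ndA mA mf f0.
have cA' := @ge0_nondecreasing_set_cvg_integral _ _ _ A' f' m' ndA' mA' mf' f'0.
apply: (cvg_unique _ cA) => //.
by rewrite (_ : (fun _ => _) = (fun n => \int[m']_(x in A' n) f' x)%E)//; exact/funext.
Qed.

Lemma itv0oy_bigcup (R : realType) :
  `]0%R, +oo[%classic = \bigcup_n `]0%R, n.+1%:R]%classic :> set R.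
Proof.
apply/seteqP; split => [x /=|x [n _] /=]; rewrite !in_itv/= !andbT; last by case/andP.
move=> x0; exists (Num.truncn x) => //=; rewrite in_itv/= x0/= ltW//.
exact: truncnS_gt.
Qed.

(** Change of variables $y = F(x)$ for a function $F$ with positive continuous
    derivative $f$ on $(0, \infty)$ and limit $0$ at $0^+$.  Continuity
    of $g$ is stated only between $0$ and the values of $F$, because for
    $F(s) = s / (1 + s)$ the beta integrand $g$ may be unbounded at $0$ and $1$. *)
Section substitution.
Context {R : realType}.
Local Notation mu := (@lebesgue_measure R).
Variables (F f g : R -> R).
Hypothesis dF : forall x : R, 0 < x -> is_derive x 1 F (f x).
Hypothesis F0 : F x @[x --> 0^'+] --> 0.
Hypothesis f_gt0 : forall x : R, 0 < x -> 0 < f x.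
Hypothesis cf : forall x : R, 0 < x -> {for x, continuous f}.
Hypothesis cg : forall x y : R, 0 < x -> 0 < y <= F x -> {for y, continuous g}.
Hypothesis g_ge0 : forall x, 0 <= g x.

Let F_continuous (x : R) : 0 < x -> {for x, continuous F}.
Proof.
by move=> x0; apply/differentiable_continuous/derivable1_diffP;
   have [] := dF x0.
Qed.

Let F_lt (x y : R) : 0 < x -> x < y -> F x < F y.
Proof.
move=> x0 xy.
have pos z : z \in `[x, y] -> 0 < z.
  by rewrite in_itv/= => /andP[xz _]; exact: lt_le_trans xz.
have [] := @MVT_segment _ F f x y (ltW xy).
- by move=> z zxy; apply: dF; apply: pos; exact: subset_itv_oo_cc zxy.
- by apply: continuous_in_subspaceT => z; rewrite inE => /pos; exact: F_continuous.
- move=> c /pos c0 FE; rewrite -subr_gt0 FE mulr_gt0 ?subr_gt0//.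
  exact: f_gt0.
Qed.

Let F_le (x y : R) : 0 < x -> x <= y -> F x <= F y.
Proof. by move=> x0; rewrite le_eqVlt => /predU1P[->//|/(F_lt x0)/ltW]. Qed.

Lemma gt0_derive_cvg0_gt0 (x : R) : 0 < x -> 0 < F x.
Proof.
move=> x0; have x20 : 0 < x / 2 by rewrite divr_gt0.
apply: (@le_lt_trans _ _ (F (x / 2))); last by apply: F_lt => //; lra.
apply: (cvgr_to_le F0); near=> z; apply: F_le => //.
by near: z; exact: nbhs_right_le.
Unshelve. all: end_near. Qed.

Let f_derive1 (x : R) : 0 < x -> F^`()%classic x = f x.
Proof. by move=> /dF ?; rewrite derive1E derive_val. Qed.

Let continuous_derive1 (x : R) : 0 < x -> {for x, continuous (F^`()%classic)}.
Proof.
move=> x0; rewrite /prop_for /continuous_at (f_derive1 x0).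
apply: cvg_trans (cf x0); apply: near_eq_cvg.
near=> y; apply/esym/f_derive1.
by near: y; exact: lt_nbhsr.
Unshelve. all: end_near. Qed.

Let continuous_integrand (x : R) : 0 < x -> {for x, continuous (fun x => g (F x) * f x)}.
Proof.
move=> x0; apply: cvgM; last exact: cf.
apply: (@continuous_comp _ _ _ F g); first exact: F_continuous.
by apply: (cg x0); rewrite gt0_derive_cvg0_gt0/=.
Qed.

Let substitution_cc (u v : R) : 0 < u -> u < v ->
  (\int[mu]_(y in `[F u, F v]) (g y)%:E =
   \int[mu]_(x in `[u, v]) (g (F x) * f x)%:E)%E.
Proof.
move=> u0 uv; have v0 := lt_trans u0 uv.
have pos z : z \in `[u, v] -> 0 < z.
  by rewrite in_itv/= => /andP[uz _]; exact: lt_le_trans uz.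
rewrite integration_by_substitution_increasing ?(ltW uv)//.
- by apply: eq_integral => x; rewrite inE/= => /pos x0; rewrite /GRing.mul/= f_derive1.
- by move=> x y /pos x0 _; exact: F_lt.
- by move=> x xuv; apply: continuous_derive1; apply: pos; exact: subset_itv_oo_cc xuv.
- apply/cvg_ex; exists (F^`()%classic u); apply: cvg_at_right_filter.
  exact: continuous_derive1.
- apply/cvg_ex; exists (F^`()%classic v); apply: cvg_at_left_filter.
  exact: continuous_derive1.
- split.
  + by move=> z zuv; have [] // := dF (pos z _); exact: subset_itv_oo_cc zuv.
  + by apply: cvg_at_right_filter; exact: F_continuous.
  + by apply: cvg_at_left_filter; exact: F_continuous.
- apply: continuous_in_subspaceT => z; rewrite inE/= in_itv/= => /andP[uz zv].
  by apply: (cg v0); rewrite zv (lt_le_trans (gt0_derive_cvg0_gt0 u0)).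
Qed.

(** Used both for $u_n = w / (n + 2)$ and for $u_n = F(w / (n + 2))$. *)
Let oc_bigcup (u : R^nat) (w : R) : (forall n, 0 < u n) -> u @ \oo --> 0 ->
  `]0%R, w]%classic = \bigcup_n `[u n, w]%classic.
Proof.
move=> u_gt0 u0; apply/seteqP; split => [y /=|y [n _] /=]; last first.
  by rewrite !in_itv/= => /andP[uy ->]; rewrite andbT (lt_le_trans _ uy).
rewrite in_itv/= => /andP[y0 yw]; have [n _ /(_ n (leqnn n)) uny] := cvgr_le 0 u0 y y0.
by exists n => //=; rewrite in_itv/= yw uny.
Qed.

Let un (w : R) n : R := w / n.+2%:R.

Let un_gt0 (w : R) n : 0 < w -> 0 < un w n. Proof. by move=> ?; rewrite divr_gt0. Qed.

Let un_lt (w : R) n : 0 < w -> un w n < w.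
Proof. by move=> w0; rewrite /un gtr_pMr// invf_lt1// ltr1n. Qed.

Let un_le (w : R) m n : 0 < w -> (m <= n)%N -> un w n <= un w m.
Proof. by move=> w0 mn; rewrite /un ler_pM2l// lef_pV2 ?posrE// ler_nat. Qed.

Let un_cvg w : un w @ \oo --> 0.
Proof.
rewrite -[0](mulr0 w); apply: cvgM; first exact: cvg_cst.
by have := @cvg_harmonic R; rewrite -(cvg_shiftn 1); under eq_fun do rewrite addn1.
Qed.

Let measurable_g n (w : R) : 0 < w -> measurable_fun `[F (un w n), F w] (EFin \o g).
Proof.
move=> w0; have cgw : {within `[F (un w n), F w], continuous g}.
  apply: continuous_in_subspaceT => z; rewrite inE/= in_itv/= => /andP[uz zw].
  by apply: (cg w0); rewrite zw (lt_le_trans _ uz)// gt0_derive_cvg0_gt0// un_gt0.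
apply/measurable_EFinP; apply: subspace_continuous_measurable_fun cgw; exact: measurable_itv.
Qed.

Let measurable_integrand (w : R) :
  measurable_fun (`]0, w] : set R) (fun x => (g (F x) * f x)%:E).
Proof.
apply/measurable_EFinP.
have mgf : measurable_fun (`]0, +oo[ : set R) (fun x => g (F x) * f x).
  apply: open_continuous_measurable_fun; first exact: interval_open.
  by move=> x; rewrite inE/= in_itv/= andbT; exact: continuous_integrand.
apply: measurable_funS mgf => //.
by move=> x /=; rewrite !in_itv/= andbT => /andP[].
Qed.

Lemma ge0_substitution_oc (r : R) : 0 < r ->
  (\int[mu]_(y in `]0%R, F r]) (g y)%:E =
   \int[mu]_(x in `]0%R, r]) (g (F x) * f x)%:E)%E.
Proof.
move=> r0; have Fr0 := gt0_derive_cvg0_gt0 r0.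
have Fu_cvg : F \o un r @ \oo --> 0.
  by move/cvg_at_rightP : F0; apply; split => // n; exact: un_gt0.
rewrite (oc_bigcup (u := F \o un r))//; last by move=> n; apply/gt0_derive_cvg0_gt0/un_gt0.
rewrite (oc_bigcup (u := un r))//; last by move=> n; exact: un_gt0.
apply: ge0_integral_bigcup_eq => //.
- move=> m n mn; apply/subsetPset; apply: subset_itvr.
  by rewrite bnd_simp; apply: F_le; [exact: un_gt0|exact: un_le].
- by move=> n; exact: measurable_g.
- by move=> n x _; rewrite lee_fin.
- by move=> m n mn; apply/subsetPset; apply: subset_itvr; rewrite bnd_simp un_le.
- move=> n; apply: measurable_funS (@measurable_integrand r) => //.
  by apply: subset_itvr; rewrite bnd_simp un_gt0.
- move=> n x /=; rewrite in_itv/= => /andP[ux _].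
  by rewrite lee_fin mulr_ge0// ltW// f_gt0// (lt_le_trans _ ux)// un_gt0.
- by move=> n; apply: substitution_cc; [exact: un_gt0|exact: un_lt].
Qed.

(** The range of $F$ is written as a union of intervals, which its users can
    identify without solving an equation $F(x) = y$. *)
Lemma ge0_substitution_oy :
  (\int[mu]_(y in \bigcup_(x in `]0%R, +oo[) `]0%R, F x]%classic) (g y)%:E =
   \int[mu]_(x in `]0%R, +oo[) (g (F x) * f x)%:E)%E.
Proof.
have -> : \bigcup_(x in `]0%R, +oo[) `]0%R, F x]%classic =
          \bigcup_n `]0%R, F n.+1%:R]%classic.
  apply/seteqP; split => [y [x] x0 /=|y [n _] yn]; last first.
    by exists n.+1%:R => //=; rewrite in_itv/= andbT.
  have : `]0%R, +oo[%classic x by [].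
  rewrite itv0oy_bigcup => -[n _] /=; rewrite !in_itv/= => /andP[x_gt0 xn] /andP[y0 yx].
  by exists n => //=; rewrite in_itv/= y0 (le_trans yx)// F_le.
rewrite itv0oy_bigcup; apply: ge0_integral_bigcup_eq => //.
- move=> m n mn; apply/subsetPset; apply: subset_itvl.
  by rewrite bnd_simp F_le// ler_nat.
- move=> n; apply/measurable_EFinP.
  rewrite (oc_bigcup (u := F \o un n.+1%:R)).
  + by apply/measurable_fun_bigcup => // k; apply/measurable_EFinP; exact: measurable_g.
  + by move=> k; apply/gt0_derive_cvg0_gt0/un_gt0.
  + by move/cvg_at_rightP : F0; apply; split => // k; exact: un_gt0.
- by move=> n x _; rewrite lee_fin.
- by move=> m n mn; apply/subsetPset; apply: subset_itvl; rewrite bnd_simp ler_nat.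
- by move=> n; exact: measurable_integrand.
- by move=> n x /=; rewrite in_itv/= => /andP[x0 _]; rewrite lee_fin mulr_ge0// ltW// f_gt0.
- by move=> n; exact: ge0_substitution_oc.
Qed.

End substitution.

(** With $g = 1$ the substitution rule computes the length of $(0, F(r)]$, which
    is the fundamental theorem of calculus for an integrand that may be unbounded
    at $0$. *)
Section improper_FTC.
Context {R : realType}.
Local Notation mu := (@lebesgue_measure R).
Variables (F f : R -> R).
Hypothesis dF : forall x : R, 0 < x -> is_derive x 1 F (f x).
Hypothesis F0 : F x @[x --> 0^'+] --> 0.
Hypothesis f_gt0 : forall x : R, 0 < x -> 0 < f x.
Hypothesis cf : forall x : R, 0 < x -> {for x, continuous f}.

Let integral_f (r : R) : 0 < r -> (\int[mu]_(x in `]0%R, r]) (f x)%:E = (F r)%:E)%E.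
Proof.
move=> r0; transitivity (\int[mu]_(x in `]0%R, r]) (cst 1 (F x) * f x)%:E)%E.
  by apply: eq_integral => x _; rewrite mul1r.
rewrite -(@ge0_substitution_oc R F f (cst 1) dF F0 f_gt0 cf) //.
  have Fr0 : 0 < F r by exact: (gt0_derive_cvg0_gt0 dF).
  rewrite -[LHS]/(\int[mu]_(x in `]0%R, F r]) (cst 1%E x))%E integral_cst//= mul1e.
  by rewrite lebesgue_measure_itv/= lte_fin Fr0 oppr0 adde0.
by move=> *; exact: cst_continuous.
Qed.

Lemma Rintegral_gt0_FTC_oc (r : R) : 0 < r -> \int[mu]_(x in `]0%R, r]) f x = F r.
Proof. by move=> r0; rewrite /Rintegral integral_f. Qed.

Lemma Rintegral_gt0_FTC_oy (l : R) : F x @[x --> +oo%R] --> l ->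
  \int[mu]_(x in `]0%R, +oo[) f x = l.
Proof.
move=> Fl; rewrite /Rintegral itv0oy_bigcup.
suff -> : (\int[mu]_(x in \bigcup_n `]0%R, n.+1%:R]%classic) (f x)%:E = l%:E)%E by [].
have cI : (\int[mu]_(x in `]0%R, n.+1%:R]) (f x)%:E)%E @[n --> \oo] -->
          (\int[mu]_(x in \bigcup_n `]0%R, n.+1%:R]%classic) (f x)%:E)%E.
  apply: ge0_nondecreasing_set_cvg_integral => //.
  - by move=> m n mn; apply/subsetPset; apply: subset_itvl; rewrite bnd_simp ler_nat.
  - move=> n; apply/measurable_EFinP.
    have mf : measurable_fun (`]0, +oo[ : set R) f.
      apply: open_continuous_measurable_fun; first exact: interval_open.
      by move=> x; rewrite inE/= in_itv/= andbT; exact: cf.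
    apply: measurable_funS mf => //.
    by move=> x /=; rewrite !in_itv/= andbT => /andP[].
  - by move=> n x /=; rewrite in_itv/= => /andP[x0 _]; rewrite lee_fin ltW// f_gt0.
apply: (cvg_unique _ cI) => //.
rewrite (_ : (fun _ => _) = EFin \o (fun n : nat => F n.+1%:R)); last first.
  by apply/funext => n; rewrite integral_f.
apply: cvg_EFin; first by near=> n.
apply: (cvg_comp (fun n : nat => n.+1%:R : R) F _ Fl).
have := @cvgr_idn R; rewrite -(cvg_shiftn 1).
by under eq_fun do rewrite addn1.
Unshelve. all: end_near. Qed.

End improper_FTC.

(** * Integration against a measure with a density *)

(** The map [phi] is an identity in the application: the Lebesgue measure and the
    chi-square law live on two measurable structures over the same reals, whose
    displays differ, and [phi] transports one to the other. *)
Section integral_density.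
Local Open Scope ereal_scope.
Context d d' (X : measurableType d) (Y : measurableType d') (R : realType).
Variables (mu : {measure set X -> \bar R}) (nu : {measure set Y -> \bar R}).
Variables (phi : X -> Y) (mphi : measurable_fun setT phi).
Variables (p : X -> R) (mp : measurable_fun setT p) (p_ge0 : forall x, (0 <= p x)%R).
Hypothesis nuE : forall A, measurable A -> nu A = \int[mu]_(x in phi @^-1` A) (p x)%:E.

Import HBNNSimple.

Lemma ge0_integral_density (f : Y -> \bar R) :
  measurable_fun setT f -> (forall y, 0 <= f y) ->
  \int[nu]_y f y = \int[mu]_x (f (phi x) * (p x)%:E).
Proof.
move=> mf f0; pose h := nnsfun_approx measurableT mf.
have mpE : measurable_fun setT (EFin \o p) by exact/measurable_EFinP.
transitivity (limn (fun n => \int[nu]_y (h n y)%:E)).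
  rewrite -monotone_convergence//=.
  - by apply: eq_integral => y _; apply/esym/cvg_lim => //; exact: cvg_nnsfun_approx.
  - by move=> n; exact/measurable_EFinP.
  - by move=> n y _; rewrite lee_fin.
  - by move=> y _ m n mn; rewrite lee_fin; exact/lefP/nd_nnsfun_approx.
transitivity (limn (fun n => \int[mu]_x ((h n (phi x))%:E * (p x)%:E))); last first.
  rewrite -monotone_convergence//=.
  - apply: eq_integral => x _; apply/cvg_lim => //; apply: cvgeZr => //.
    exact: cvg_nnsfun_approx.
  - move=> n; apply: emeasurable_funM => //; apply/measurable_EFinP.
    exact: measurableT_comp.
  - by move=> n x _; rewrite mule_ge0 ?lee_fin.
  - move=> x _ m n mn; rewrite lee_wpmul2r ?lee_fin//.
    exact/lefP/nd_nnsfun_approx.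
congr (limn _); apply/funext => n; rewrite integralT_nnsfun sintegralE.
have mhn r : measurable_fun setT (fun x => \1_(phi @^-1` (h n @^-1` [set r])) x : R).
  apply: measurable_indic; rewrite -[X in measurable X]setTI.
  exact: mphi.
transitivity (\int[mu]_x \sum_(r \in range (h n))
    (r%:E * (\1_(phi @^-1` (h n @^-1` [set r])) x * p x)%:E)).
  rewrite ge0_integral_fsum//.
  - apply: eq_fsbigr => r; rewrite inE => -[y _ <-].
    rewrite ge0_integralZl//= ?lee_fin//.
    + rewrite nuE//; congr (_ * _); rewrite integral_mkcond; apply: eq_integral => x _.
      by rewrite patchE indicE; case: ifP => _; rewrite ?mul1r ?mul0r.
    + by apply/measurable_EFinP; exact: measurable_funM.
    + by move=> x _; rewrite lee_fin mulr_ge0.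
  - by move=> r; apply/measurable_EFinP; apply: measurable_funM => //; exact: measurable_funM.
  - move=> r x _; rewrite -EFinM mulrA EFinM mule_ge0 ?lee_fin//.
    exact: (nnfun_muleindic_ge0 (h n) r (phi x)).
apply: eq_integral => x _.
rewrite (fimfunE (h n) (phi x)) -fsumEFin// ge0_mule_fsuml; last first.
  by move=> r; exact: (nnfun_muleindic_ge0 (h n) r (phi x)).
by apply: eq_fsbigr => r _; rewrite -!EFinM mulrA.
Qed.

End integral_density.


(** * The chi-square law and gamma integrals *)

Section chi2.
Context {R : realType}.
Local Notation mu := (@lebesgue_measure R).
Implicit Types a b c k m n t x y s r : R.

Definition gamma_integrand a x := x `^ (a - 1) * expR (- x).

(** The chi-square density as a formula valid for $x > 0$, without the case
    distinction that makes [chi2_pdf] vanish elsewhere; this form is continuous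
    on the domain of integration and supports substitution. *)
Definition chi2_density k x :=
  x `^ (k / 2 - 1) * expR (- (x / 2)) / (2 `^ (k / 2) * gamma_fun (k / 2)).

Lemma gamma_integrand_ge0 a x : 0 <= gamma_integrand a x.
Proof. by rewrite mulr_ge0 ?powR_ge0 ?expR_ge0. Qed.

Lemma chi2_density_ge0 k x : 0 <= chi2_density k x.
Proof. by rewrite divr_ge0 ?mulr_ge0 ?powR_ge0 ?expR_ge0 ?gamma_fun_ge0. Qed.

Lemma continuous_powR_gt0 a x : 0 < x -> {for x, continuous (fun y => y `^ a)}.
Proof.
move=> x0; apply: differentiable_continuous; apply/derivable1_diffP.
by apply: derivable_powR; rewrite in_itv/= x0.
Qed.

Lemma continuous_gamma_integrand a x : 0 < x -> {for x, continuous (gamma_integrand a)}.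
Proof.
move=> x0; apply: cvgM; first exact: continuous_powR_gt0.
apply: (@continuous_comp _ _ _ -%R (@expR R)); first exact: opp_continuous.
exact: continuous_expR.
Qed.

Lemma continuous_chi2_density k x : 0 < x -> {for x, continuous (chi2_density k)}.
Proof.
move=> x0; apply: cvgM; last exact: cvg_cst.
apply: cvgM; first exact: continuous_powR_gt0.
apply: (@continuous_comp _ _ _ (fun x => - (x / 2)) (@expR R)).
  by apply: cvgN; apply: cvgM; [exact: cvg_id|exact: cvg_cst].
exact: continuous_expR.
Qed.

Lemma measurable_gamma_integrand a : measurable_fun setT (gamma_integrand a).
Proof.
apply: measurable_funM; first exact: measurable_powR.
exact: measurableT_comp.
Qed.

Lemma measurable_chi2_density k : measurable_fun setT (chi2_density k).
Proof.
apply: measurable_funM => //; apply: measurable_funM; first exact: measurable_powR.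
apply: measurableT_comp => //; apply: measurableT_comp => //.
exact: measurable_funM.
Qed.

Lemma chi2_probE k (A : set R) : 0 < k ->
  chi2_prob k A = (\int[mu]_(x in A `&` `]0%R, +oo[) (chi2_density k x)%:E)%E.
Proof.
move=> k0; rewrite /chi2_prob k0 integral_mkcondr; apply: eq_integral => x _.
by rewrite patchE mem_setE in_itv/= andbT /chi2_pdf; case: ifP.
Qed.

Lemma ge0_integral_chi2 k (f : R -> \bar R) : 0 < k ->
  measurable_fun setT f -> (forall x, 0 <= f x)%E ->
  (\int[chi2_prob k]_x f x =
   \int[mu]_(x in `]0%R, +oo[) (f x * (chi2_density k x)%:E))%E.
Proof.
move=> k0 mf f0.
pose phi : measurableTypeR R -> R := idfun.
have mphi : measurable_fun setT phi by move=> _ B mB; rewrite setTI.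
rewrite (@ge0_integral_density _ _ _ _ R mu (chi2_prob k) phi mphi (chi2_pdf k))//.
- rewrite [RHS]integral_mkcond; apply: eq_integral => x _.
  rewrite patchE mem_setE in_itv/= andbT /chi2_pdf/=; case: ifP => //.
  by move=> _; rewrite mule0.
- exact: measurable_chi2_pdf.
- by move=> x; exact: chi2_pdf_ge0.
- by move=> A mA; rewrite [LHS]/= /chi2_prob k0; reflexivity.
Qed.

Lemma bigcup_scale_oy c : 0 < c ->
  \bigcup_(x in `]0%R, +oo[) `]0%R, c * x]%classic = `]0%R, +oo[%classic :> set R.
Proof.
move=> c0; apply/seteqP; split => [y [x _] /=|y /=]; rewrite !in_itv/= ?andbT.
  by case/andP.
move=> y0; exists (y / c); first by rewrite /= in_itv/= andbT divr_gt0.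
by rewrite /= in_itv/= y0/= mulrC divfK// gt_eqF.
Qed.

Lemma is_derive_scale c x : is_derive x 1 ( *%R c) c.
Proof.
rewrite (_ : *%R c = c \*: (id : R^o -> R^o))//; apply: is_derive_eq.
by rewrite scaler1.
Qed.

Lemma cvg_scale0 c : c * x @[x --> 0^'+] --> 0.
Proof.
rewrite -[X in _ --> X](mulr0 c); apply: cvg_at_right_filter.
by apply: cvgM; [exact: cvg_cst|exact: cvg_id].
Qed.

Lemma ge0_integral_scale_oc c r (g : R -> R) : 0 < c -> 0 < r ->
  (forall x : R, 0 < x -> {for x, continuous g}) -> (forall x, 0 <= g x) ->
  (\int[mu]_(y in `]0%R, (c * r)%R]) (g y)%:E =
   \int[mu]_(x in `]0%R, r]) (g (c * x) * c)%:E)%E.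
Proof.
move=> c0 r0 cg g0; apply: (@ge0_substitution_oc R ( *%R c) (cst c) g) => //.
- by move=> x _; exact: is_derive_scale.
- exact: cvg_scale0.
- by move=> x _; exact: cst_continuous.
- by move=> x y _ /andP[y0 _]; exact: cg.
Qed.

Lemma ge0_integral_scale_oy c (g : R -> R) : 0 < c ->
  (forall x : R, 0 < x -> {for x, continuous g}) -> (forall x, 0 <= g x) ->
  (\int[mu]_(y in `]0%R, +oo[) (g y)%:E =
   \int[mu]_(x in `]0%R, +oo[) (g (c * x) * c)%:E)%E.
Proof.
move=> c0 cg g0; rewrite -[in LHS](bigcup_scale_oy c0).
apply: (@ge0_substitution_oy R ( *%R c) (cst c) g) => //.
- by move=> x _; exact: is_derive_scale.
- exact: cvg_scale0.
- by move=> x _; exact: cst_continuous.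
- by move=> x y _ /andP[y0 _]; exact: cg.
Qed.

(** $\int_0^\infty y^{c-1} e^{-ty} dy = t^{-c}\,\Gamma(c)$, by $y \mapsto ty$. *)
Lemma integral_gamma_scale c t : 0 < t ->
  (\int[mu]_(y in `]0%R, +oo[) (y `^ (c - 1) * expR (- (t * y)))%:E =
   (t `^ (- c))%:E * \int[mu]_(y in `]0%R, +oo[) (gamma_integrand c y)%:E)%E.
Proof.
move=> t0; rewrite [X in (_ * X)%E](ge0_integral_scale_oy t0); last 2 first.
- by move=> x; exact: continuous_gamma_integrand.
- exact: gamma_integrand_ge0.
rewrite -ge0_integralZl_EFin//.
- apply: eq_integral => y; rewrite inE/= in_itv/= andbT => y0.
  rewrite -EFinM; congr EFin; rewrite /gamma_integrand powRM ?ltW//.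
  have -> : t `^ (c - 1) = t `^ c / t.
    by rewrite powRB ?powRr1 ?(gt_eqF t0) ?implybT// ltW.
  by rewrite powRN; field; rewrite ?gt_eqF ?powR_gt0.
- by move=> y _; rewrite lee_fin mulr_ge0 ?gamma_integrand_ge0 ?ltW.
- apply/measurable_funTS/measurable_EFinP; apply: measurable_funM => //.
  apply: (measurableT_comp (@measurable_gamma_integrand c)).
  exact: measurable_funM.
- exact: powR_ge0.
Qed.

(** The product measure is defined by slicing along the first coordinate; by
    Tonelli it can be sliced along the second one, which lets the computations
    below condition on the denominator of the ratio. *)
Lemma product_measure_ysection d d' (X : measurableType d) (Y : measurableType d')
    (P : probability X R) (Q : probability Y R) (E : set (X * Y)) : measurable E ->
  ((P \x Q) E = \int[Q]_y P (ysection E y))%E.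
Proof.
move=> mE; have m1E : measurable_fun setT (EFin \o \1_E : X * Y -> \bar R).
  by apply/measurable_EFinP; exact: measurable_indic.
rewrite -[in LHS](setIT E) -integral_indic// (fubini_tonelli2 (EFin \o \1_E))//=.
by rewrite indic_fubini_tonelli_GE.
Qed.

End chi2.

(** * Ratio of two independent chi-square variables *)

Lemma ge0_exchange_integral d d' (X : measurableType d) (Y : measurableType d')
    (R : realType) (m : {sigma_finite_measure set X -> \bar R})
    (m' : {sigma_finite_measure set Y -> \bar R}) (A : set X) (B : set Y)
    (h : X * Y -> R) : measurable A -> measurable B -> measurable_fun setT h ->
  (forall x y, A x -> B y -> 0 <= h (x, y)) ->
  (\int[m]_(x in A) \int[m']_(y in B) (h (x, y))%:E =
   \int[m']_(y in B) \int[m]_(x in A) (h (x, y))%:E)%E.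
Proof.
move=> mA mB mh h0; pose f := (EFin \o h) \_ (A `*` B).
have mf : measurable_fun setT f.
  apply/(measurable_restrictT _ (measurableX mA mB)).
  by apply/measurable_funTS/measurable_EFinP.
have f0 z : (0 <= f z)%E.
  rewrite /f patchE; case: ifPn => //; rewrite inE => -[Az Bz].
  by rewrite lee_fin; case: z Az Bz => x y; exact: h0.
have fE x y : f (x, y) = (if x \in A then if y \in B then (h (x, y))%:E else 0 else 0)%E.
  by rewrite /f patchE in_setX; case: (x \in A); case: (y \in B).
have := fubini_tonelli (m1 := m) (m2 := m') f mf f0.
under eq_integral do under eq_integral do rewrite fE.
under [X in _ = X -> _]eq_integral do under eq_integral do rewrite fE.
move=> H; rewrite [LHS]integral_mkcond [RHS]integral_mkcond.
transitivity (\int[m]_x \int[m']_y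
    (if x \in A then if y \in B then (h (x, y))%:E else 0 else 0))%E.
  apply: eq_integral => x _; rewrite patchE; case: ifPn => _.
    by rewrite [LHS]integral_mkcond; apply: eq_integral => y _; rewrite patchE.
  by rewrite integral0.
rewrite H; apply: eq_integral => y _; rewrite patchE; case: ifPn => yB.
  by rewrite [RHS]integral_mkcond; apply: eq_integral => x _; rewrite patchE; case: ifP.
by rewrite integral0_eq// => x _; case: ifP.
Qed.

Section ratio.
Context {R : realType}.
Local Notation mu := (@lebesgue_measure R).
Implicit Types a b c k m n t x y s r z : R.

(** Unnormalized density of the beta prime law, the law of $T / (1 - T)$ when $T$
    has the beta law of parameters $a$ and $b$. *)
Definition beta_prime_integrand a b s := s `^ (a - 1) * (1 + s) `^ (- (a + b)).

Lemma beta_prime_integrand_ge0 a b s : 0 <= beta_prime_integrand a b s.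
Proof. by rewrite mulr_ge0 ?powR_ge0. Qed.

Lemma measurable_beta_prime_integrand a b :
  measurable_fun setT (beta_prime_integrand a b).
Proof.
apply: measurable_funM; first exact: measurable_powR.
apply: (measurableT_comp (@measurable_powR R _)); exact: measurable_funD.
Qed.

(** This is $\Gamma(a+b) / (\Gamma(a)\Gamma(b))$, kept as an extended real: that
    it is finite and equal to $1 / B(a, b)$ will come out of the total mass of the
    ratio law. *)
Definition ratio_constant a b : \bar R :=
  (((gamma_fun a * gamma_fun b)^-1)%:E *
   \int[mu]_(y in `]0%R, +oo[) (gamma_integrand (a + b) y)%:E)%E.

Lemma ratio_constant_ge0 a b : (0 <= ratio_constant a b)%E.
Proof.
rewrite mule_ge0 ?lee_fin ?invr_ge0 ?mulr_ge0 ?gamma_fun_ge0// integral_ge0// => y _.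
by rewrite lee_fin gamma_integrand_ge0.
Qed.

(** The joint density at $(ys, y)$, times the Jacobian $y$ of $x = ys$, is a
    function of $s$ times a gamma integrand in $y$ with rate $(1+s)/2$. *)
Lemma chi2_density_ratio m n y s : 0 < y -> 0 < s ->
  chi2_density m (y * s) * y * chi2_density n y =
  (2 `^ (m / 2 + n / 2) * gamma_fun (m / 2) * gamma_fun (n / 2))^-1 *
  s `^ (m / 2 - 1) *
  (y `^ (m / 2 + n / 2 - 1) * expR (- ((1 + s) / 2 * y))).
Proof.
move=> y0 s0; rewrite /chi2_density powRM ?ltW//.
set a := m / 2; set b := n / 2.
have -> : expR (- ((1 + s) / 2 * y)) = expR (- (y * s / 2)) * expR (- (y / 2)).
  by rewrite -expRD; congr expR; field.
have -> : y `^ (a + b - 1) = y `^ (a - 1) * y * y `^ (b - 1).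
  have -> : a + b - 1 = (a - 1) + 1 + (b - 1) by ring.
  by rewrite !powRD ?powRr1 ?(gt_eqF y0) ?implybT// ltW.
have -> : 2 `^ (a + b) = 2 `^ a * 2 `^ b :> R.
  by rewrite powRD// pnatr_eq0 implybT.
rewrite !invfM; ring.
Qed.

(** After $x = ys$ the two integrals are exchanged; integrating the gamma factor
    in $y$ first leaves $((1+s)/2)^{-(a+b)} \Gamma(a+b)$, whose powers of two
    cancel against the normalization of the chi-square densities. *)
Lemma integral_chi2_ratio m n (D : set R) : measurable D -> D `<=` `]0%R, +oo[ ->
  (\int[mu]_(y in `]0%R, +oo[) ((\int[mu]_(s in D) (chi2_density m (y * s) * y)%:E) *
     (chi2_density n y)%:E) =
   ratio_constant (m / 2) (n / 2) *
   \int[mu]_(s in D) (beta_prime_integrand (m / 2) (n / 2) s)%:E)%E.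
Proof.
move=> mD D0.
have Dpos s : D s -> 0 < s by move=> /D0 /=; rewrite in_itv/= andbT.
have m1 c y : measurable_fun setT (fun s => chi2_density c (y * s)).
  by apply: (measurableT_comp (@measurable_chi2_density R c)); exact: measurable_funM.
pose h (z : R * R) := chi2_density m (z.1 * z.2) * z.1 * chi2_density n z.1.
have mh : measurable_fun [set: R * R] h.
  apply: measurable_funM; last first.
    exact: (measurableT_comp (@measurable_chi2_density R n)).
  apply: measurable_funM => //.
  apply: (measurableT_comp (@measurable_chi2_density R m)).
  exact: measurable_funM.
transitivity (\int[mu]_(y in `]0%R, +oo[) \int[mu]_(s in D) (h (y, s))%:E)%E.
  apply: eq_integral => y; rewrite inE/= in_itv/= andbT => y0.
  rewrite -ge0_integralZr//.
  - by apply/measurable_funTS/measurable_EFinP; apply: measurable_funM => //; exact: m1.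
  - by move=> s _; rewrite lee_fin mulr_ge0 ?chi2_density_ge0// ltW.
  - by rewrite lee_fin chi2_density_ge0.
rewrite ge0_exchange_integral//; last first.
- move=> y s /=; rewrite in_itv/= andbT => y0 _.
  apply: mulr_ge0; last exact: chi2_density_ge0.
  by apply: mulr_ge0; [exact: chi2_density_ge0|exact: ltW].
set a := m / 2; set b := n / 2.
rewrite -ge0_integralZl//; last 3 first.
- by apply/measurable_funTS/measurable_EFinP; exact: measurable_beta_prime_integrand.
- by move=> s _; rewrite lee_fin beta_prime_integrand_ge0.
- exact: ratio_constant_ge0.
apply: eq_integral => s; rewrite inE => /Dpos s0.
transitivity (\int[mu]_(y in `]0%R, +oo[)
  (((2 `^ (a + b) * gamma_fun a * gamma_fun b)^-1 * s `^ (a - 1))%:E *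
   (y `^ (a + b - 1) * expR (- ((1 + s) / 2 * y)))%:E))%E.
  apply: eq_integral => y; rewrite inE/= in_itv/= andbT => y0.
  by rewrite -EFinM; congr EFin; exact: chi2_density_ratio.
rewrite ge0_integralZl_EFin//; last 3 first.
- by move=> y _; rewrite lee_fin mulr_ge0 ?powR_ge0 ?expR_ge0.
- apply/measurable_funTS/measurable_EFinP; apply: measurable_funM.
    exact: measurable_powR.
  by apply: measurableT_comp => //; apply: measurableT_comp => //; exact: measurable_funM.
- by rewrite mulr_ge0 ?powR_ge0// invr_ge0 !mulr_ge0 ?powR_ge0 ?gamma_fun_ge0.
rewrite integral_gamma_scale; last by rewrite divr_gt0// addr_gt0.
rewrite muleA -EFinM /ratio_constant [RHS]muleAC -EFinM; congr (_%:E * _)%E.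
rewrite /beta_prime_integrand (powRM _ (_ : 0 <= 1 + s)) ?invr_ge0 ?addr_ge0 ?ltW//.
have -> : 2^-1 `^ (- (a + b)) = 2 `^ (a + b) :> R.
  by rewrite -powR_inv1// -powRrM mulN1r opprK.
rewrite !invfM.
have : 2 `^ (a + b) != 0 :> R by rewrite gt_eqF// powR_gt0.
move: (2 `^ (a + b)) => w w0.
transitivity ((w / w) * ((gamma_fun a)^-1 * (gamma_fun b)^-1 *
  (s `^ (a - 1) * (1 + s) `^ (- (a + b))))); first ring.
by rewrite divff// mul1r.
Qed.

End ratio.

(** * The incomplete beta function in the variable s = t / (1 - t) *)

Section beta.
Context {R : realType}.
Local Notation mu := (@lebesgue_measure R).
Implicit Types a b c k m n t x y s r z : R.

Let odds s := s / (1 + s).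
Let beta_integrand a b t := t `^ (a - 1) * (1 - t) `^ (b - 1).

Let odds_lt1 s : 0 < s -> odds s < 1.
Proof. by move=> s0; rewrite /odds ltr_pdivrMr ?addr_gt0// mul1r ltrDr. Qed.

Let is_derive_odds s : 0 < s -> is_derive s 1 odds ((1 + s) ^- 2).
Proof.
move=> s0; have s1 : 1 + s != 0 by rewrite gt_eqF// addr_gt0.
have d1 : is_derive s (1 : R) (fun u : R => 1 + u) 1.
  by apply: is_derive_eq; rewrite add0r mulr1.
have dV := is_deriveV s1 d1.
have -> : (1 + s) ^- 2 = s *: (- (1 + s) ^- 2 *: 1) + (1 + s)^-1 *: 1.
  by rewrite !scaler1 /GRing.scale/=; field.
exact: is_deriveM.
Qed.

Let cvg_odds : odds s @[s --> 0^'+] --> 0.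
Proof.
rewrite -[X in _ --> X](_ : odds 0 = 0); last by rewrite /odds mul0r.
apply: cvg_at_right_filter; apply: cvgM; first exact: cvg_id.
apply: cvgV; first by rewrite addr0 oner_eq0.
by apply: cvgD; [exact: cvg_cst|exact: cvg_id].
Qed.

Let continuous_sqV s : 0 < s -> {for s, continuous (fun u : R => (1 + u) ^- 2)}.
Proof.
move=> s0; apply: cvgV; first by rewrite gt_eqF// exprn_gt0// addr_gt0.
apply: (@continuous_comp _ _ _ (fun u : R => 1 + u) (fun u : R => u ^+ 2)).
  by apply: cvgD; [exact: cvg_cst|exact: cvg_id].
exact: exprn_continuous.
Qed.

Let continuous_beta_integrand a b t : 0 < t < 1 -> {for t, continuous (beta_integrand a b)}.
Proof.
move=> /andP[t0 t1]; apply: cvgM; first exact: continuous_powR_gt0.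
apply: (@continuous_comp _ _ _ (fun u : R => 1 - u) (fun u : R => u `^ (b - 1))).
  by apply: cvgB; [exact: cvg_cst|exact: cvg_id].
by apply: continuous_powR_gt0; rewrite subr_gt0.
Qed.

Let beta_integrand_ge0 a b t : 0 <= beta_integrand a b t.
Proof. by rewrite mulr_ge0 ?powR_ge0. Qed.

Let measurable_beta_integrand a b D : measurable_fun D (EFin \o beta_integrand a b).
Proof.
apply/measurable_funTS/measurable_EFinP; apply: measurable_funM.
  exact: measurable_powR.
by apply: (measurableT_comp (@measurable_powR R _)); exact: measurable_funB.
Qed.

Let beta_integrand_odds a b s : 0 < s ->
  beta_integrand a b (odds s) * (1 + s) ^- 2 = beta_prime_integrand a b s.
Proof.
move=> s0; have s1 : 0 < 1 + s by rewrite addr_gt0.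
rewrite /beta_integrand /beta_prime_integrand.
have -> : 1 - odds s = (1 + s)^-1 by rewrite /odds; field; rewrite gt_eqF.
rewrite /odds powRM ?invr_ge0 ?ltW// -!mulrA; congr (_ * _).
rewrite -powR_inv1 ?ltW// -!powRrM -powR_invn ?ltW//.
rewrite -!powRD ?(gt_eqF s1) ?implybT//; congr (_ `^ _); ring.
Qed.

Lemma integral_beta_prime_oc a b z : 0 < z ->
  (\int[mu]_(s in `]0%R, z]) (beta_prime_integrand a b s)%:E =
   \int[mu]_(t in `[0%R, (z / (1 + z))%R]) (t `^ (a - 1) * (1 - t) `^ (b - 1))%:E)%E.
Proof.
move=> z0; rewrite -[RHS]integral_itv_obnd_cbnd; last exact: measurable_beta_integrand.
rewrite (@ge0_substitution_oc R odds (fun s : R => (1 + s) ^- 2) (beta_integrand a b)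
  is_derive_odds cvg_odds)//.
- apply: eq_integral => s; rewrite inE/= in_itv/= => /andP[s0 _].
  by rewrite beta_integrand_odds.
- by move=> s s0; rewrite invr_gt0 exprn_gt0// addr_gt0.
- move=> x y x0 /andP[y0 yx]; apply: continuous_beta_integrand.
  by rewrite y0 (le_lt_trans yx)// odds_lt1.
Qed.

Lemma integral_beta_prime_oy a b :
  (\int[mu]_(s in `]0%R, +oo[) (beta_prime_integrand a b s)%:E =
   \int[mu]_(t in `[0%R, 1%R]) (t `^ (a - 1) * (1 - t) `^ (b - 1))%:E)%E.
Proof.
rewrite integral_itv_bndoo; last exact: measurable_beta_integrand.
have <- : \bigcup_(x in `]0%R, +oo[) `]0%R, odds x]%classic = `]0%R, 1%R[%classic :> set R.
  apply/seteqP; split => [y [x] /=|y /=]; rewrite !in_itv/= ?andbT.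
    by move=> x0 /andP[-> yx]; rewrite (le_lt_trans yx)// odds_lt1.
  move=> /andP[y0 y1]; exists (y / (1 - y)).
    by rewrite /= in_itv/= andbT divr_gt0// subr_gt0.
  rewrite /= in_itv/= y0/= /odds le_eqVlt; apply/orP; left; apply/eqP; field.
  by rewrite subrK oner_eq0/= subr_eq0 gt_eqF.
rewrite (@ge0_substitution_oy R odds (fun s : R => (1 + s) ^- 2) (beta_integrand a b)
  is_derive_odds cvg_odds)//.
- apply: eq_integral => s; rewrite inE/= in_itv/= andbT => s0.
  by rewrite beta_integrand_odds.
- by move=> s s0; rewrite invr_gt0 exprn_gt0// addr_gt0.
- move=> x y x0 /andP[y0 yx]; apply: continuous_beta_integrand.
  by rewrite y0 (le_lt_trans yx)// odds_lt1.
Qed.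

Lemma reg_inc_betaE a b z : 0 < z ->
  reg_inc_beta (z / (1 + z)) a b =
  (\int[mu]_(s in `]0%R, z]) beta_prime_integrand a b s) /
  (\int[mu]_(s in `]0%R, +oo[) beta_prime_integrand a b s).
Proof.
move=> z0; rewrite /reg_inc_beta /inc_beta_fun /Rintegral.
by rewrite integral_beta_prime_oc// integral_beta_prime_oy.
Qed.

End beta.

(** * The F distribution *)

(** Turns a normalization identity between extended reals into finiteness of both
    factors. *)
Lemma gt0_mule_eq1 (R : realDomainType) (x y : \bar R) : (0 <= x)%E -> (0 <= y)%E ->
  (x * y = 1)%E -> exists2 r, 0 < r & x = r%:E /\ (y = (fine y)%:E /\ r * fine y = 1).
Proof.
move=> + + xy1; have : (x * y != 0)%E by rewrite xy1 onee_eq0.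
rewrite mule_eq0 negb_or => /andP[x0 y0] x_ge0 y_ge0.
have {x0}x_gt0 : (0 < x)%E by rewrite lt0e x0.
have {y0}y_gt0 : (0 < y)%E by rewrite lt0e y0.
move: x y x_gt0 y_gt0 xy1 {x_ge0 y_ge0} => [r| |] [s| |] //=.
- by move=> r0 _ [rs1]; exists r.
- by move=> r0 _; rewrite gt0_muley.
- by move=> _ s0; rewrite gt0_mulye.
Qed.

Section F_law.
Context {R : realType}.
Local Notation mu := (@lebesgue_measure R).
Implicit Types a b c k m n t x y s r z : R.

(** The chi-square law charges only positive numbers. *)
Lemma eq_integral_chi2 k (f g : R -> \bar R) : 0 < k ->
  measurable_fun setT f -> (forall x, 0 <= f x)%E ->
  measurable_fun setT g -> (forall x, 0 <= g x)%E ->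
  (forall x, 0 < x -> f x = g x) ->
  (\int[chi2_prob k]_x f x = \int[chi2_prob k]_x g x)%E.
Proof.
move=> k0 mf f0 mg g0 fg; rewrite !ge0_integral_chi2//.
by apply: eq_integral => x; rewrite inE/= in_itv/= andbT => /fg ->.
Qed.

Lemma F_probE m n (A : set R) : 0 < m -> 0 < n -> measurable A ->
  (F_prob m n A = \int[mu]_(y in `]0%R, +oo[)
    (chi2_prob m [set x | A (x / m / (y / n))%R] * (chi2_density n y)%:E))%E.
Proof.
move=> m0 n0 mA.
have mE : measurable (F_ratio m n @^-1` A) by exact: measurable_funPTI.
rewrite [LHS]product_measure_ysection// ge0_integral_chi2//.
- apply: eq_integral => y _; congr (chi2_prob m _ * _)%E.
  by apply/seteqP; split => x; rewrite /ysection/= inE.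
- exact: measurable_fun_ysection.
Qed.

Lemma chi2_prob_le m z y : 0 < m -> 0 < z -> 0 < y ->
  chi2_prob m [set x | x <= (y * z)%R] =
  (\int[mu]_(s in `]0%R, z]) (chi2_density m (y * s) * y)%:E)%E.
Proof.
move=> m0 z0 y0; rewrite -ge0_integral_scale_oc//.
- rewrite chi2_probE//; congr (integral _ _ _); apply/seteqP.
  by split=> x /=; rewrite !in_itv/= andbT; [move=> [-> ->]|move=> /andP[]].
- by move=> x; exact: continuous_chi2_density.
- exact: chi2_density_ge0.
Qed.

Lemma F_prob_le m n c : 0 < m -> 0 < n -> 0 < c ->
  F_prob m n [set x | x <= c] = (ratio_constant (m / 2) (n / 2) *
    \int[mu]_(s in `]0%R, (m * c / n)%R]) (beta_prime_integrand (m / 2) (n / 2) s)%:E)%E.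
Proof.
move=> m0 n0 c0; rewrite F_probE//; last by rewrite -set_itvNyc.
have z0 : 0 < m * c / n by rewrite divr_gt0 ?mulr_gt0.
rewrite -integral_chi2_ratio//; last first.
  by apply: subset_itvl.
apply: eq_integral => y; rewrite inE/= in_itv/= andbT => y0.
rewrite -chi2_prob_le//; congr (chi2_prob m _ * _)%E.
apply/seteqP; split => x /=; rewrite ler_pdivrMr ?divr_gt0// ler_pdivrMr//;
  by rewrite (_ : c * (y / n) * m = y * (m * c / n))//; ring.
Qed.

(** The ratio law is a probability, which normalizes the beta prime density. *)
Lemma ratio_constant_total m n : 0 < m -> 0 < n ->
  (ratio_constant (m / 2) (n / 2) *
   \int[mu]_(s in `]0%R, +oo[) (beta_prime_integrand (m / 2) (n / 2) s)%:E = 1)%E.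
Proof.
move=> m0 n0; rewrite -integral_chi2_ratio//.
rewrite -(@probability_setT _ _ _ (F_prob m n)) F_probE//.
apply: eq_integral => y; rewrite inE/= in_itv/= andbT => y0.
congr (_ * _)%E; rewrite -ge0_integral_scale_oy//.
- by rewrite chi2_probE//; congr (integral _ _ _); rewrite setTI.
- by move=> x; exact: continuous_chi2_density.
- exact: chi2_density_ge0.
Qed.

(** With $K$ the ratio constant, $P(F \le c) = K B_z$ and $1 = K B_\infty$, where
    $B_z$ is the integral of the beta prime density up to $z = mc/n$; hence
    $P(F \le c) = B_z / B_\infty$, a ratio of incomplete beta integrals. *)
Lemma F_prob_gt m n c : 0 < m -> 0 < n -> 0 < c ->
  F_prob m n [set x | x > c] =
  (1 - reg_inc_beta (m * c / (m * c + n)) (m / 2) (n / 2))%:E.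
Proof.
move=> m0 n0 c0.
have -> : [set x : R | x > c] = ~` [set x | x <= c].
  by apply/seteqP; split => x /=; rewrite ltNge => /negP.
have mc : measurable [set x : R | x <= c] by rewrite -set_itvNyc.
rewrite probability_setC//.
have z0 : 0 < m * c / n by rewrite divr_gt0 ?mulr_gt0.
have -> : m * c / (m * c + n) = (m * c / n) / (1 + m * c / n).
  by field; rewrite !gt_eqF// addr_gt0// mulr_gt0.
rewrite reg_inc_betaE//.
have KB := @ratio_constant_total m n m0 n0.
have KBz := @F_prob_le m n c m0 n0 c0.
set p := F_prob m n _ in KBz *.
have pfin : p \is a fin_num by exact: fin_num_measure.
rewrite /Rintegral.
have B_ge0 (D : set R) :
    (0 <= \int[mu]_(s in D) (beta_prime_integrand (m / 2) (n / 2) s)%:E)%E.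
  by apply: integral_ge0 => s _; rewrite lee_fin beta_prime_integrand_ge0.
move: KB KBz (B_ge0 `]0%R, +oo[%classic) (B_ge0 `]0%R, (m * c / n)%R]%classic).
set K := ratio_constant _ _; set B := (\int[mu]_(x in `]0%R, +oo[) _)%E.
set Bz := (\int[mu]_(x in `]0%R, _]) _)%E => KB pE B0 Bz0.
have [|k k0 [KE [_ kB]]] := gt0_mule_eq1 _ B0 KB.
  exact: ratio_constant_ge0.
move: pE; rewrite KE; case: Bz Bz0 => [q| |//] _ pE.
- rewrite pE -EFinM -EFinB; congr (_ - _)%:E => /=.
  have B0' : fine B != 0.
    by apply/eqP => fB; move: kB; rewrite fB mulr0 => /esym/eqP; rewrite oner_eq0.
  by apply: (mulIf B0'); rewrite divfK// mulrAC kB mul1r.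
- by move: pfin; rewrite pE gt0_muley.
Qed.

End F_law.

(** * The square of a normal variable *)

Section normal_chi2.
Context {R : realType}.
Local Notation mu := (@lebesgue_measure R).
Implicit Types a b c k m n t x y s r z u : R.

Lemma is_derive_scale_sqr c u : is_derive u 1 (fun v : R => c * v ^+ 2) (2 * c * u).
Proof.
by apply: is_derive_eq; rewrite /GRing.scale/=; ring.
Qed.

Lemma cvg_scale_sqr0 c : c * u ^+ 2 @[u --> 0^'+] --> 0.
Proof.
rewrite -[X in _ --> X](mulr0 c); apply: cvg_at_right_filter.
apply: cvgM; first exact: cvg_cst.
by rewrite -[X in _ --> X](expr0n R 2); exact: exprn_continuous.
Qed.

Lemma continuous_scale c u : {for u, continuous (fun v : R => c * v)}.
Proof. by apply: cvgM; [exact: cvg_cst|exact: cvg_id]. Qed.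

Lemma powR_sqr_neg_half u : 0 < u -> (u ^+ 2) `^ (1 / 2 - 1) = u^-1.
Proof.
move=> u0; rewrite -powR_mulrn ?ltW// -powRrM -[RHS]powR_inv1 ?ltW//.
congr (_ `^ _); lra.
Qed.

(** Substituting $t = u^2$ turns $\Gamma(1/2)$ into the Gauss integral. *)
Lemma gamma_fun_half : gamma_fun (1 / 2) = Num.sqrt pi :> R.
Proof.
rewrite /gamma_fun /Rintegral.
have <- : \bigcup_(x in `]0%R, +oo[) `]0%R, 1 * x ^+ 2]%classic = `]0%R, +oo[%classic :> set R.
  apply/seteqP; split => [y [x _] /=|y /=]; rewrite !in_itv/= ?andbT.
    by case/andP.
  (* y <= (y + 1)^2 avoids taking a square root *)
  move=> y0; exists (y + 1); first by rewrite /= in_itv/= andbT addr_gt0.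
  by rewrite /= in_itv/= y0/=; nra.
rewrite (@ge0_substitution_oy R _ _ (gamma_integrand (1 / 2))
  (fun u _ => is_derive_scale_sqr 1 u) (@cvg_scale_sqr0 1))//.
- transitivity (fine (\int[mu]_(u in `]0%R, +oo[) (2%:E * (gauss_fun u)%:E)))%E.
    congr fine; apply: eq_integral => u; rewrite inE/= in_itv/= andbT => u0.
    rewrite -EFinM; congr EFin.
    rewrite /gamma_integrand (mul1r (u ^+ 2)) powR_sqr_neg_half// /gauss_fun.
    by field; rewrite gt_eqF.
  rewrite ge0_integralZl_EFin//; last 2 first.
    by move=> u _; rewrite lee_fin gauss_fun_ge0.
    by apply/measurable_funTS/measurable_EFinP; exact: measurable_gauss_fun.
  rewrite integral_itv_obnd_cbnd; last first.
    by apply/measurable_funTS/measurable_EFinP; exact: measurable_gauss_fun.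
  by rewrite integral0y_gauss/=; field.
- by move=> u u0; rewrite mulr1 mulr_gt0.
- by move=> u _; exact: continuous_scale.
- by move=> x y _ /andP[y0 _]; exact: continuous_gamma_integrand.
- exact: gamma_integrand_ge0.
Qed.

Let sqrt2_neq0 : Num.sqrt 2 != 0 :> R. Proof. by rewrite gt_eqF// sqrtr_gt0. Qed.

Lemma normal_pdf_sqrt2E u :
  normal_pdf 0 (Num.sqrt 2) u = expR (- (u ^+ 2 / 4)) / (2 * Num.sqrt pi) :> R.
Proof.
rewrite normal_pdfE// /normal_peak /normal_fun sqr_sqrtr// subr0.
have -> : 2 * pi *+ 2 = (2 * Num.sqrt pi) ^+ 2 :> R.
  by rewrite exprMn sqr_sqrtr ?pi_ge0//; ring.
rewrite sqrtr_sqr ger0_norm ?mulr_ge0// mulrC; congr (expR _ * _).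
by rewrite mulNr; congr (- (_ / _)); ring.
Qed.

Lemma normal_law_norm_lt r : 0 < r ->
  normal_law 0 (Num.sqrt 2) [set a | `|a| < r] =
  (\int[mu]_(u in `]0%R, r]) (expR (- (u ^+ 2 / 4)) / Num.sqrt pi)%:E)%E.
Proof.
move=> r0; pose f := normal_pdf 0 (Num.sqrt 2 : R).
have mf D : measurable_fun D (EFin \o f).
  by apply/measurable_funTS/measurable_EFinP; exact: measurable_normal_pdf.
have f0 x : (0 <= (f x)%:E)%E by rewrite lee_fin normal_pdf_ge0.
have cf : continuous f by exact: continuous_normal_pdf.
rewrite /normal_law /normal_prob.
have -> : [set a : R | `|a| < r] = `]- r, 0] `|` `]0, r[.
  apply/seteqP; split => u /=; rewrite !in_itv/= ltr_norml.
    by move=> /andP[-> ->]; have [|] := leP u 0; [left|right].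
  move=> [/andP[-> u0]|/andP[u0 ->]]/=; first exact: le_lt_trans r0.
  by rewrite andbT (lt_trans _ u0)// oppr_lt0.
rewrite ge0_integral_setU//=; last 2 first.
- exact: mf.
- by apply/disj_setPS => u /=; rewrite !in_itv/= => -[/andP[_ u0] /andP[]]; rewrite ltNge u0.
rewrite integral_itv_bndoo; last exact: mf.
rewrite -(@integral_itv_bndoo R _ _ _ true false); last exact: mf.
rewrite -[X in `[_, X]]oppr0 integration_by_substitution_oppr ?ltW//; last first.
  by apply: continuous_subspaceT => u; exact: cf.
have mfN D : measurable_fun D (EFin \o (f \o -%R)).
  apply/measurable_funTS/measurable_EFinP; apply: measurableT_comp => //.
  exact: measurable_normal_pdf.
rewrite integral_itv_bndoo; last exact: mfN.
rewrite [RHS]integral_itv_bndoo; last first.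
  apply/measurable_funTS/measurable_EFinP; apply: measurable_funM => //.
  apply: measurableT_comp => //; apply: measurableT_comp => //.
  by apply: measurable_funM => //; exact: measurable_funX.
rewrite -ge0_integralD//; last 3 first.
- by move=> u _; exact: f0.
- exact: mfN.
- exact: mf.
apply: eq_integral => u _; rewrite -EFinD; congr EFin => /=.
rewrite !normal_pdf_sqrt2E sqrrN; field.
by rewrite gt_eqF// sqrtr_gt0 pi_gt0.
Qed.

(** If $a$ is $N(0, 2)$ then $a^2 / 2$ is $\chi^2_1$: the substitution is
    $y = u^2 / 2$, and the constants match because $\Gamma(1/2) = \sqrt{\pi}$. *)
Lemma normal_law_chi2 x : 0 < x ->
  normal_law 0 (Num.sqrt 2) [set a | `|a| < Num.sqrt x] =
  chi2_prob 1 [set y | 2 * y < x].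
Proof.
move=> x0; have r0 : 0 < Num.sqrt x by rewrite sqrtr_gt0.
rewrite normal_law_norm_lt// chi2_probE//.
have -> : [set y : R | 2 * y < x] `&` `]0, +oo[ = `]0, x / 2[%classic.
  apply/seteqP; split => y /=; rewrite !in_itv/= ?andbT.
    by move=> [yx ->]/=; rewrite ltr_pdivlMr// mulrC.
  by move=> /andP[-> yx]; split => //; rewrite mulrC -ltr_pdivlMr.
rewrite -(@integral_itv_bndoo R _ _ _ false false); last first.
  by apply/measurable_funTS/measurable_EFinP; exact: measurable_chi2_density.
have -> : x / 2 = 2^-1 * Num.sqrt x ^+ 2 by rewrite sqr_sqrtr ?ltW// mulrC.
rewrite (@ge0_substitution_oc R _ _ (chi2_density 1)
  (fun u _ => is_derive_scale_sqr 2^-1 u) (@cvg_scale_sqr0 2^-1))//.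
- apply: eq_integral => u; rewrite inE/= in_itv/= => /andP[u0 _]; congr EFin.
  rewrite /chi2_density gamma_fun_half powRM ?invr_ge0 ?sqr_ge0//.
  rewrite powR_sqr_neg_half//.
  have -> : 2^-1 `^ (1 / 2 - 1) = 2 `^ (1 / 2) :> R.
    by rewrite -[X in X `^ _ = _]powR_inv1// -powRrM; congr (_ `^ _); lra.
  have : 2 `^ (1 / 2) != 0 :> R by rewrite gt_eqF// powR_gt0.
  have : Num.sqrt pi != 0 :> R by rewrite gt_eqF// sqrtr_gt0 pi_gt0.
  have -> : 2^-1 * u ^+ 2 / 2 = u ^+ 2 / 4 by field.
  by move=> p0 w0; field; rewrite p0 w0 gt_eqF.
- by move=> u u0; rewrite divff// mul1r.
- by move=> u _; exact: continuous_scale.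
- by move=> y z _ /andP[z0 _]; exact: continuous_chi2_density.
- exact: chi2_density_ge0.
Qed.

End normal_chi2.

(** * The probability of a row swap *)

Lemma measurable_pred_set d (T : measurableType d) (f : T -> bool) :
  measurable_fun setT f -> measurable [set x | f x].
Proof.
by move=> mf; rewrite -[X in measurable X]setTI; exact: (mf measurableT [set true]).
Qed.

Section swap.
Context {R : realType}.
Local Notation mu := (@lebesgue_measure R).
Implicit Types beta x y : R.

Let swap_event : set 'M[R]_2 := [set A | `|A 1 0| > `|A 0 0|].

Lemma gepp_swapsE (A : 'M[R]_2) : gepp_swaps A = nat_of_bool (`|A 0 0| < `|A 1 0|).
Proof. by rewrite /gepp_swaps; case: ifP. Qed.

Lemma measurable_swap_event : measurable swap_event.
Proof.
rewrite (_ : swap_event = gepp_swaps @^-1` [set 1%N]); first exact: measurable_funPTI.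
by apply/seteqP; split => A; rewrite /swap_event/= gepp_swapsE; case: (_ < _).
Qed.

Let measurable_lt2 : measurable [set z : R * R | `|z.1| < `|z.2| ].
Proof.
pose f (z : R * R) := `|z.1| < `|z.2|.
have mf : measurable_fun setT f by apply: measurable_fun_ltr; apply: measurableT_comp.
exact: measurable_pred_set mf.
Qed.

Let measurable_gt2 : measurable [set z : R * R | 2 * z.2 < z.1 ].
Proof.
pose f (z : R * R) := 2 * z.2 < z.1.
have mf : measurable_fun setT f.
  by apply: measurable_fun_ltr => //; exact: measurable_funM.
exact: measurable_pred_set mf.
Qed.

(** The factor $1 / \sqrt 2$ cancels in $|A_{21}| > |A_{11}|$, and the entry
    $a_2$ integrates out. *)
Lemma hermite2_swapE beta :
  hermite2 beta swap_event =
  (\int[chi_prob beta]_b normal_law 0 (Num.sqrt 2) [set a | (`|a| < `|b|)%R])%E.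
Proof.
have E : hermite2_mx @^-1` swap_event =
    [set z : R * R * R | `|z.1.1| < `|z.2| ].
  have s2 : 0 < (Num.sqrt 2)^-1 :> R by rewrite invr_gt0 sqrtr_gt0.
  by apply/seteqP; split => -[[a1 a2] b] /=; rewrite /swap_event/= !mxE/=;
    rewrite !normrM ltr_pM2l// normr_gt0 gt_eqF.
transitivity ((normal_law 0 (Num.sqrt 2) \x normal_law 0 (Num.sqrt 2) \x chi_prob beta)%E
    [set z : R * R * R | `|z.1.1| < `|z.2| ]); first by rewrite -E.
rewrite product_measure_ysection; last first.
  pose f (z : R * R * R) := `|z.1.1| < `|z.2|.
  have mf : measurable_fun setT f.
    apply: measurable_fun_ltr; last exact: measurableT_comp.
    by apply: measurableT_comp => //; exact: measurableT_comp.
  exact: measurable_pred_set mf.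
apply: eq_integral => b _.
have -> : ysection [set z : R * R * R | `|z.1.1| < `|z.2| ] b =
    [set a | `|a| < `|b| ] `*` setT.
  by apply/seteqP; split => -[a1 a2] /=; rewrite /ysection/= inE => // -[].
transitivity (normal_law 0 (Num.sqrt 2) [set a | (`|a| < `|b|)%R] *
    normal_law 0 (Num.sqrt 2) [set: R])%E; last by rewrite probability_setT mule1.
apply: product_measure1E => //.
pose f (a : R) := `|a| < `|b|.
have mf : measurable_fun setT f by exact: measurable_fun_ltr.
exact: measurable_pred_set mf.
Qed.

(** Conditionally on $b^2 = x$, the event $a_1^2 < x$ has the probability that
    $2Y < x$ for $Y \sim \chi^2_1$; so the swap event has the probability of
    $X > 2Y$ with $X \sim \chi^2_\beta$ independent of $Y$, which is the event
    $(X / \beta) / Y > 2 / \beta$. *)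
Lemma hermite2_swap_F beta : 0 < beta ->
  hermite2 beta swap_event = F_prob beta 1 [set x | x > 2 / beta].
Proof.
move=> beta0; rewrite hermite2_swapE.
pose G (b : R) : \bar R := normal_law 0 (Num.sqrt 2) [set a | `|a| < `|b| ].
have mG : measurable_fun setT G.
  rewrite (_ : G = normal_law 0 (Num.sqrt 2) \o ysection [set z : R * R | `|z.1| < `|z.2| ]).
    exact: measurable_fun_ysection.
  apply/funext => b /=; congr (normal_law _ _ _); apply/seteqP.
  by split => a; rewrite /ysection/= inE.
have G0 b : (0 <= G b)%E by exact: measure_ge0.
pose C (x : R) : \bar R := chi2_prob 1 [set y : R | 2 * y < x].
have CE : C = chi2_prob 1 \o xsection [set z : R * R | 2 * z.2 < z.1 ].
  apply/funext => x /=; congr (chi2_prob _ _); apply/seteqP.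
  by split => y; rewrite /xsection/= inE.
have mC : measurable_fun setT C by rewrite CE; exact: measurable_fun_xsection.
have C0 x : (0 <= C x)%E by exact: measure_ge0.
have msqrt : measurable_fun setT (@Num.sqrt R).
  by apply: continuous_measurable_fun; exact: sqrt_continuous.
transitivity (\int[chi2_prob beta]_x G (Num.sqrt x))%E.
  by rewrite /chi_prob ge0_integral_pushforward// preimage_setT.
transitivity (\int[chi2_prob beta]_x C x)%E.
  apply: eq_integral_chi2 => //; first exact: measurableT_comp.
  by move=> x x0; rewrite /G ger0_norm// normal_law_chi2.
transitivity ((chi2_prob beta \x chi2_prob 1)%E [set z : R * R | 2 * z.2 < z.1 ]).
  by rewrite CE.
(* from here on conditioning is on the denominator Y instead of on X *)
transitivity (\int[chi2_prob 1]_y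
    chi2_prob beta (ysection [set z : R * R | (2 * z.2 < z.1)%R] y))%E.
  exact: product_measure_ysection.
rewrite ge0_integral_chi2//; last exact: measurable_fun_ysection.
rewrite [RHS]F_probE//; last by rewrite -set_itvoy.
apply: eq_integral => y; rewrite inE/= in_itv/= andbT => y0.
congr (chi2_prob _ _ * _)%E; apply/seteqP; split => x; rewrite /ysection/= inE/=;
  by rewrite divr1 ltr_pdivlMr// ltr_pdivlMr// mulrAC divfK// gt_eqF.
Qed.

Lemma swap_prob_betaE beta : 0 < beta ->
  swap_prob beta = 1 - reg_inc_beta (2 / 3) (beta / 2) (1 / 2).
Proof.
move=> beta0; rewrite /swap_prob -/swap_event hermite2_swap_F// F_prob_gt ?divr_gt0//=.
by rewrite (mulrC beta) divfK ?gt_eqF// (_ : 2 + 1 = 3)//; ring.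
Qed.

End swap.

(** * Special values *)

Section special_values.
Context {R : realType}.
Local Notation mu := (@lebesgue_measure R).
Implicit Types s x y : R.

Lemma swap_prob_beta_primeE (beta : R) : 0 < beta -> swap_prob beta =
  1 - (\int[mu]_(s in `]0%R, 2%R]) beta_prime_integrand (beta / 2) (1 / 2) s) /
      (\int[mu]_(s in `]0%R, +oo[) beta_prime_integrand (beta / 2) (1 / 2) s).
Proof.
move=> beta0; rewrite (swap_prob_betaE beta0).
have two_gt0 : 0 < 2 :> R by [].
rewrite -(reg_inc_betaE (beta / 2) (1 / 2) two_gt0).
by have -> : 1 + 2 = 3 :> R by ring.
Qed.

(** In the variable $s$ the threshold $2/3$ becomes $2$, and any antiderivative of
    the beta prime density vanishing at $0^+$ gives the swap probability. *)
Lemma swap_prob_antiderivative (beta : R) (F : R -> R) (l : R) : 0 < beta ->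
  (forall s, 0 < s -> is_derive s 1 F (beta_prime_integrand (beta / 2) (1 / 2) s)) ->
  F s @[s --> 0^'+] --> 0 -> F s @[s --> +oo] --> l ->
  swap_prob beta = 1 - F 2 / l.
Proof.
move=> beta0 dF F0 Fl; rewrite swap_prob_beta_primeE//.
have f_gt0 s : 0 < s -> 0 < beta_prime_integrand (beta / 2) (1 / 2) s.
  by move=> s0; rewrite mulr_gt0 ?powR_gt0 ?addr_gt0.
have cf s : 0 < s -> {for s, continuous (beta_prime_integrand (beta / 2) (1 / 2))}.
  move=> s0; apply: cvgM; first exact: continuous_powR_gt0.
  apply: (@continuous_comp _ _ _ (fun u : R => 1 + u) (fun u : R => u `^ _)).
    by apply: cvgD; [exact: cvg_cst|exact: cvg_id].
  by apply: continuous_powR_gt0; rewrite addr_gt0.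
by rewrite (Rintegral_gt0_FTC_oc dF F0 f_gt0 cf)// (Rintegral_gt0_FTC_oy dF F0 f_gt0 cf Fl).
Qed.

End special_values.

Section values.
Context {R : realType}.
Implicit Types s x y : R.

(** The antiderivatives for $\beta = 2$ and $\beta = 4$ are polynomials in
    $(1 + s)^{-1/2}$. *)
Let rsqrt s := (1 + s) `^ (- (1 / 2)).

Let rsqrtE s : 0 <= s -> rsqrt s = (Num.sqrt (1 + s))^-1.
Proof. by move=> s0; rewrite /rsqrt powRN mul1r powR12_sqrt// addr_ge0. Qed.

Let rsqrtX s n : rsqrt s ^+ n = (1 + s) `^ (- (n%:R / 2)).
Proof. by rewrite /rsqrt -powR_mulrn ?powR_ge0// -powRrM; congr (_ `^ _); lra. Qed.

Let is_derive_rsqrt s : 0 < s -> is_derive s 1 rsqrt (- (1 / 2) * rsqrt s ^+ 3).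
Proof.
move=> s0; have s1 : 0 < 1 + s by rewrite addr_gt0.
have d1 : is_derive s (1 : R) (fun u : R => 1 + u) 1.
  by apply: is_derive_eq; rewrite add0r mulr1.
have d2 := @is_derive1_powR R (- (1 / 2)) (1 + s) s1.
have := is_derive1_comp d2 d1; rewrite mulr1 rsqrtX.
by rewrite (_ : - (1 / 2) - 1 = - (3%:R / 2))//; lra.
Qed.

Let cvg_rsqrt0 : rsqrt s @[s --> 0^'+] --> (1 : R).
Proof.
rewrite -[X in _ --> X](_ : rsqrt 0 = 1); last by rewrite /rsqrt addr0 powR1.
apply: cvg_at_right_filter.
apply: (@continuous_comp _ _ _ (fun u : R => 1 + u) (fun u : R => u `^ (- (1 / 2)))).
  by apply: cvgD; [exact: cvg_cst|exact: cvg_id].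
by apply: continuous_powR_gt0; rewrite addr0.
Qed.

Let cvg_rsqrty : rsqrt s @[s --> +oo] --> 0.
Proof.
apply: (@cvg_trans _ ((Num.sqrt (1 + s))^-1 @[s --> +oo])).
  by apply: near_eq_cvg; near=> s; rewrite rsqrtE.
apply: (gtr0_cvgV0 (f := fun s : R => Num.sqrt (1 + s)) _).2.
  by near=> s; rewrite sqrtr_gt0 addr_gt0.
apply/cvgryPge => A; near=> s.
apply: (@le_trans _ _ `|A|); first exact: ler_norm.
rewrite -sqrtr_sqr ler_sqrt; last by rewrite addr_ge0.
apply: (@le_trans _ _ s); last by rewrite lerDr.
by near: s; apply: nbhs_pinfty_ge; rewrite num_real.
Unshelve. all: end_near. Qed.

Let sqrt3_gt0 : 0 < Num.sqrt 3 :> R. Proof. by rewrite sqrtr_gt0. Qed.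

Let rsqrt2 : rsqrt 2 = (Num.sqrt 3)^-1.
Proof. by rewrite rsqrtE// (_ : 1 + 2 = 3)//; ring. Qed.

Lemma swap_prob1 : swap_prob (1 : R) = 1 - 2 / pi * atan (Num.sqrt 2).
Proof.
transitivity (1 - 2 * atan (Num.sqrt 2) / pi : R); last by rewrite mulrAC.
apply: (@swap_prob_antiderivative R 1 (fun s => 2 * atan (Num.sqrt s)) pi) => //.
- move=> s s0; rewrite /beta_prime_integrand.
  have d := is_derive1_comp (is_derive1_atan (Num.sqrt s)) (is_derive1_sqrt s0).
  have -> : s `^ (1 / 2 - 1) = (Num.sqrt s)^-1.
    rewrite -powR12_sqrt ?ltW// -powRN; congr (_ `^ _); lra.
  rewrite (_ : - (1 / 2 + 1 / 2) = -1); last by lra.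
  rewrite powR_inv1 ?addr_ge0 ?ltW//.
  apply: is_derive_eq; rewrite /GRing.scale/= sqr_sqrtr ?ltW//.
  by field; rewrite !gt_eqF ?addr_gt0 ?sqrtr_gt0.
- rewrite -[X in _ --> X](_ : 2 * atan (Num.sqrt 0) = 0 :> R); last first.
    by rewrite sqrtr0 atan0 mulr0.
  apply: cvg_at_right_filter; apply: cvgM; first exact: cvg_cst.
  apply: (@continuous_comp _ _ _ (@Num.sqrt R) (@atan R)).
    exact: sqrt_continuous.
  exact: continuous_atan.
- rewrite -[X in _ --> X](_ : 2 * (pi / 2) = pi :> R); last by field.
  apply: cvgM; first exact: cvg_cst.
  apply: (cvg_comp _ _ _ (@cvgy_atan R)).
  apply/cvgryPge => A; near=> s.
  apply: (@le_trans _ _ `|A|); first exact: ler_norm.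
  rewrite -sqrtr_sqr; apply: ler_wsqrtr.
  by near: s; apply: nbhs_pinfty_ge; rewrite num_real.
Unshelve. all: end_near. Qed.

Lemma swap_prob2 : swap_prob (2 : R) = 1 / Num.sqrt 3.
Proof.
transitivity (1 - (2 - 2 * rsqrt 2) / 2); last by rewrite rsqrt2; field; rewrite gt_eqF.
apply: (@swap_prob_antiderivative R 2 (fun s => 2 - 2 * rsqrt s) 2) => //.
- move=> s s0; have := is_derive_rsqrt s0 => dv.
  rewrite /beta_prime_integrand divff// subrr powRr0 mul1r.
  rewrite (_ : - (1 + 1 / 2) = - (3%:R / 2)); last by lra.
  by rewrite -rsqrtX; apply: is_derive_eq; rewrite /GRing.scale/=; field.
- rewrite -[X in _ --> X](_ : 2 - 2 * 1 = 0 :> R); last by ring.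
  by apply: cvgB; [exact: cvg_cst|apply: cvgM; [exact: cvg_cst|exact: cvg_rsqrt0]].
- rewrite -[X in _ --> X](_ : 2 - 2 * 0 = 2 :> R); last by ring.
  by apply: cvgB; [exact: cvg_cst|apply: cvgM; [exact: cvg_cst|exact: cvg_rsqrty]].
Qed.

Lemma swap_prob4 : swap_prob (4 : R) = 4 / (3 * Num.sqrt 3).
Proof.
pose F s := 4 / 3 - 2 * rsqrt s + 2 / 3 * rsqrt s ^+ 3.
have cvgF (G : set_system R) (FG : Filter G) (l : R) : rsqrt s @[s --> G] --> l ->
    F s @[s --> G] --> 4 / 3 - 2 * l + 2 / 3 * l ^+ 3.
  move=> vl; apply: cvgD; first apply: cvgB; first exact: cvg_cst.
    by apply: cvgM => //; exact: cvg_cst.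
  apply: cvgM; first exact: cvg_cst.
  by apply: (cvg_comp rsqrt (fun u => u ^+ 3) vl); exact: exprn_continuous.
transitivity (1 - F 2 / (4 / 3)); last first.
  rewrite /F rsqrt2.
  have q : (Num.sqrt 3)^-1 ^+ 3 = (3 * Num.sqrt 3)^-1 :> R.
    by rewrite exprVn exprS sqr_sqrtr// mulrC.
  by rewrite q; field; rewrite gt_eqF.
have four_gt0 : 0 < 4 :> R by [].
apply: (@swap_prob_antiderivative R 4 F (4 / 3) four_gt0).
- move=> s s0; have := is_derive_rsqrt s0 => dv.
  rewrite /beta_prime_integrand.
  rewrite (_ : 4 / 2 - 1 = 1 :> R); last by lra.
  rewrite powRr1 ?ltW// (_ : - (4 / 2 + 1 / 2) = - (5%:R / 2)); last by lra.
  rewrite -rsqrtX /F; apply: is_derive_eq; rewrite /GRing.scale/=.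
  (* the derivative is v^3 - v^5 with v = (1 + s)^(-1/2), and s v^2 = 1 - v^2 *)
  have sE : s * rsqrt s ^+ 2 = 1 - rsqrt s ^+ 2.
    rewrite rsqrtX divff// powR_inv1 ?addr_ge0 ?ltW//; field.
    by rewrite gt_eqF// addr_gt0.
  have -> : s * rsqrt s ^+ 5 = (s * rsqrt s ^+ 2) * rsqrt s ^+ 3 by ring.
  by rewrite sE; field.
- rewrite -[X in _ --> X](_ : 4 / 3 - 2 * 1 + 2 / 3 * 1 ^+ 3 = 0 :> R); last by field.
  exact: cvgF.
- rewrite -[X in _ --> X](_ : 4 / 3 - 2 * 0 + 2 / 3 * 0 ^+ 3 = 4 / 3 :> R); last by field.
  exact: cvgF.
Qed.

End values.

Theorem mainTheorem2 (R : realType) :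
  (forall (beta : R) (d : measure_display) (Omega : measurableType d)
      (P : probability Omega R) (A : {RV P >-> 'M[R]_2}),
    0 < beta ->
    has_law A (hermite2 beta) ->
    [/\ distribution P (gepp_swaps \o A)
          = pushforward (bernoulli_prob (swap_prob beta)) nat_of_bool,
        (swap_prob beta)%:E = P [set w | `|A w 1 0| > `|A w 0 0|],
        P [set w | `|A w 1 0| > `|A w 0 0|]
          = F_prob beta 1 [set x | x > 2 / beta]
      & F_prob beta 1 [set x | x > 2 / beta]
          = (1 - reg_inc_beta (2 / 3) (beta / 2) (1 / 2))%:E])
  /\ [/\ swap_prob (1 : R) = 1 - 2 / pi * atan (Num.sqrt 2),
         swap_prob (2 : R) = 1 / Num.sqrt 3
       & swap_prob (4 : R) = 4 / (3 * Num.sqrt 3)].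
Proof.
split; last by split; [exact: swap_prob1|exact: swap_prob2|exact: swap_prob4].
move=> beta d Omega P A beta0 lawA.
have PE : P [set w | `|A w 1 0| > `|A w 0 0|] = (swap_prob beta)%:E.
  have -> : (swap_prob beta)%:E = hermite2 beta [set B | `|B 0 0| < `|B 1 0| ].
    by rewrite fineK// fin_num_measure//; exact: measurable_swap_event.
  by rewrite -lawA//; exact: measurable_swap_event.
pose E := [set w | `|A w 0 0| < `|A w 1 0| ].
have mE : measurable E.
  rewrite (_ : E = A @^-1` [set B | `|B 0 0| < `|B 1 0| ])//.
  by apply: measurable_funPTI; exact: measurable_swap_event.
split.
- have p01 : 0 <= swap_prob beta <= 1.
    by rewrite -!lee_fin -PE probability_le1 ?measure_ge0//; exact: mE.
  apply/funext => S; rewrite /pushforward (bernoulli_probE p01).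
  (* the values are 0 and 1, so the preimage of S is determined by which of
     the two belong to S; this covers arbitrary sets S of naturals *)
  have ES : (gepp_swaps \o A) @^-1` S =
      (if 1%N \in S then E else set0) `|` (if 0%N \in S then ~` E else set0).
    apply/seteqP; split => w /=; rewrite /E gepp_swapsE.
      by case: ltP => Aw /mem_set ->; [left|right => /=; rewrite ltNge Aw].
    case; first by case: ifPn => // /set_mem S1 ->.
    by case: ifPn => // /set_mem S0 /negP/negbTE ->.
  transitivity (P ((if 1%N \in S then E else set0) `|` (if 0%N \in S then ~` E else set0))).
    by rewrite -ES.
  rewrite measureU; last 3 first.
  + by case: ifP => // _; exact: mE.
  + by case: ifP => // _; apply: measurableC; exact: mE.
  + by case: ifP => _; case: ifP => _; rewrite ?set0I ?setI0 ?setICr.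
  have memS (b : bool) : (b \in nat_of_bool @^-1` S) = (nat_of_bool b \in S).
    by apply/idP/idP; rewrite !inE.
  rewrite !diracE !memS/=; congr (_ + _)%E; case: ifP => _.
  + by rewrite mule1 PE.
  + by rewrite mule0 measure0.
  + by rewrite mule1 probability_setC// PE.
  + by rewrite mule0 measure0.
- exact/esym.
- rewrite PE -hermite2_swap_F//.
  by rewrite fineK// fin_num_measure//; exact: measurable_swap_event.
- rewrite -hermite2_swap_F// -swap_prob_betaE//.
  by rewrite fineK// fin_num_measure//; exact: measurable_swap_event.
Qed.
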